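(* Let $M\ge 2$ be an integer and $\mathbf{p}=(p_0,\dots,p_{M-1})\in[0,1]^M$ with $\sum_{k=0}^{M-1}p_k>1$. Let $F_1,F_2$ be two independent copies of the random Cantor set $F$ generated by $\mathbf{p}$, and let $\gamma_0,\dots,\gamma_M$ be the cyclic autocorrelations of $\mathbf{p}$. Then, conditional on $F_1\neq\emptyset$ and $F_2\neq\emptyset$: (a) If $\gamma_k>1$ for all $k$, then $F_2-F_1$ contains an interval almost surely. (b) If there exists $k\in\{0,\dots,M-1\}$ such that $\gamma_k<1$ and $\gamma_{k+1}<1$, then $F_2-F_1$ almost surely does not contain any interval.
   Context: Random Cantor set generated by $\mathbf{p}$: to every finite string $i_1\dots i_n$ with $n\ge 0$ and $i_k\in\{0,\dots,M-1\}$ (the empty string $\emptyset$ being the only string of length $0$) attach a label $X_{i_1\dots i_n}\in\{0,1\}$. The labels are independent Bernoulli random variables under a probability measure $\mathbb{P}_{\mathbf{p}}$ with $\mathbb{P}_{\mathbf{p}}(X_\emptyset=1)=1$ and $\mathbb{P}_{\mathbf{p}}(X_{i_1\dots i_n}=1)=p_{i_n}$ for $n\ge1$. Put $$I_{i_1\dots i_n}=\Big[\sum_{k=1}^n\frac{i_k}{M^k},\ \sum_{k=1}^n\frac{i_k}{M^k}+\frac1{M^n}\Big],\qquad S_n=\{i_1\dots i_n: X_{i_1}=X_{i_1i_2}=\dots=X_{i_1\dots i_n}=1\},$$ $F^n=\bigcup_{i_1\dots i_n\in S_n}I_{i_1\dots i_n}$ and $F=\bigcap_{n\ge1}F^n\subset[0,1]$.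 The values $p_i=0$ and $p_i=1$ are allowed, and $\mathbf{p}$ is in general not a probability vector. The underlying probability for the pair $(F_1,F_2)$ is $\mathbb{P}=\mathbb{P}_{\mathbf{p}}\times\mathbb{P}_{\mathbf{p}}$. The algebraic difference is $F_2-F_1=\{x_2-x_1: x_1\in F_1,\ x_2\in F_2\}$. Cyclic autocorrelations: with indices extended by $p_{M+j}=p_j$ for $j=0,\dots,M$, set $\gamma_k=\sum_{j=0}^{M-1}p_jp_{j+k}$ for $k=0,\dots,M$ (so $\gamma_M=\gamma_0$). ''Interval'' means a nondegenerate interval (of positive length). *)

(* Defs.v *)
From HB Require Import structures.
From mathcomp Require Import all_boot all_order all_algebra.
From mathcomp Require Import all_classical all_reals all_analysis.

Set Implicit Arguments.
Unset Strict Implicit.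
Unset Printing Implicit Defensive.

Import Order.TTheory GRing.Theory Num.Theory.
Import numFieldNormedType.Exports.

Local Open Scope classical_set_scope.
Local Open Scope ring_scope.

(* A finite string i_1...i_n over {0, ..., M-1} is the list [:: i_1; ...; i_n]
   of type seq 'I_M. *)

Definition mutually_independent (R : realType) (d d' : measure_display)
    (T : measurableType d) (T' : measurableType d') (P : probability T R)
    (I : choiceType) (X : I -> {RV P >-> T'}) : Prop :=
  forall (J : seq I) (B : I -> set T'), uniq J ->
    (forall i, measurable (B i)) ->
    P (\bigcap_(i in [set` J]) X i @^-1` B i) =
    \big[*%E/1%E]_(i <- J) P (X i @^-1` B i).

Definition random_labels (R : realType) (d : measure_display)
    (T : measurableType d) (P : probability T R) (M : nat) (p : 'I_M -> R)
    (X : seq 'I_M -> {RV P >-> bool}) : Prop :=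
  [/\ mutually_independent X,
      P (X [::] @^-1` [set true]) = 1%:E &
      forall (s : seq 'I_M) (i : 'I_M),
        P (X (rcons s i) @^-1` [set true]) = (p i)%:E].

Definition mary_interval (R : realType) (M n : nat) (s : n.-tuple 'I_M) :
    set R :=
  let x : R := \sum_(k < n) (tnth s k : nat)%:R / M%:R ^+ k.+1 in
  `[x, x + 1 / M%:R ^+ n].
Arguments mary_interval R {M n} s _.

(* take k s is the prefix i_1...i_k; the label of the empty string (k = 0) is
   not tested. *)
Definition surviving (M : nat) (x : seq 'I_M -> bool) (n : nat) :
    set (n.-tuple 'I_M) :=
  [set s : n.-tuple 'I_M | forall k, (1 <= k <= n)%N -> x (take k s)].
Arguments surviving {M} x n _.

Definition cantor_approx (R : realType) (M : nat) (x : seq 'I_M -> bool)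
    (n : nat) : set R :=
  \bigcup_(s in surviving x n) mary_interval R s.
Arguments cantor_approx R {M} x n _.

Definition cantor_set (R : realType) (M : nat) (x : seq 'I_M -> bool) :
    set R :=
  \bigcap_(n in [set n | (1 <= n)%N]) cantor_approx R x n.
Arguments cantor_set R {M} x _.

(* The index j + k reduced mod M: this is p_(j + k) for the cyclic extension
   p_(M + j) = p_j. *)
Definition cyclic_shift (M : nat) (j : 'I_M) (k : nat) : 'I_M :=
  Ordinal (ltn_pmod (j + k) (leq_ltn_trans (leq0n j) (ltn_ord j))).

Definition cyclic_autocorrelation (R : realType) (M : nat) (p : 'I_M -> R)
    (k : nat) : R :=
  \sum_(j < M) p j * p (cyclic_shift j k).

Definition algebraic_difference (R : realType) (A B : set R) : set R :=
  [set a - b | a in A & b in B].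

Definition contains_interval (R : realType) (A : set R) : Prop :=
  exists J : set R,
    [/\ is_interval J, exists x y, [/\ J x, J y & x < y] & J `<=` A].

(* Main.v *)
Require Import Defs.
From mathcomp Require Import all_boot all_order all_algebra.
From mathcomp Require Import all_classical all_reals all_analysis.
From mathcomp Require Import zify ring lra.

(** Code an M-adic interval of generation [n] by the integer position of its left
    endpoint, scaled by [M ^ n].  For a labelling of both trees, let [N_n(c)] be the
    number of pairs of surviving words of length [n], one in each tree, whose
    positions differ by exactly [c].  Such a pair of intervals has
    difference set [[c-1, c+1] / M ^ n], so the column [[c, c+1] / M ^ n] of the
    line is met, up to its endpoints, only by the pairs counted in [N_n(c)] and
    [N_n(c+1)].  Passing to the subcolumn [M * c + k], a pair at [c] has on
    average [a_k] children there and a pair at [c+1] has [a_(k-M)], where [a_z]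
    is the sum of the products [p_i p_j] over [j - i = z]; and
    [a_k + a_(k-M) = gamma_k].

    If [gamma_k] and [gamma_(k+1)] are below [r < 1], then along the nested columns
    [c, Mc + k, M(Mc + k) + k, ...] the larger of the expectations of [N(c)] and
    [N(c+1)] is multiplied by at most [r] at each generation.  Hence almost surely
    every column contains a subcolumn whose interior the difference set avoids
    ([column_dies]), and every nondegenerate interval contains a column ([no_interval_ae]).

    If all [gamma_k > 1], then once [N] is at least a large number [h] at both
    ends of a block of consecutive integers and between them, a Chernoff bound
    makes [N] larger by a fixed factor on the M times longer block of the next
    generation, outside an event of probability at most the length of the block
    times [tau ^ h] with [tau < 1].  Thresholds growing linearly in the
    generation, but steeply enough, make these errors summable to at most 1/2
    ([growth_thresholds], [all_segments_chance]).  Pairs counted in the same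
    [N_n(c)] use distinct words in either tree, which gives the
    independence that the Chernoff bound needs.  The required initial size is
    reached from any single surviving pair with a positive probability bounded
    below ([seed_chance]): [gamma_1 > 1] forces two consecutive digits of positive
    probability, and keeping all words over these two digits doubles the counts
    at each generation.  So, whatever the labels up to generation [n], as soon
    as both trees survive there, with conditional probability at least [q > 0]
    some whole column stays populated for ever ([uniform_chance]), and by
    compactness that column lies in the difference set
    ([segments_fill_interval]).  If a trial fails, it fails at a finite
    generation, and a fresh trial starts there; so the probability that both
    trees survive while all trials fail is at most [(1 - q) ^ k] for every [k]
    ([all_trials_fail_null]).

    Probabilities of events depending on finitely many labels are computed by an
    operator [avg] that integrates out labels one at a time; applied to the
    labels of later generations only, it is the conditional expectation given
    the earlier ones. *)

Set Implicit Arguments.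
Unset Strict Implicit.
Unset Printing Implicit Defensive.

Import Order.TTheory GRing.Theory Num.Theory.
Import numFieldNormedType.Exports.

Local Open Scope classical_set_scope.
Local Open Scope ring_scope.

(** * Averaging over finitely many labels *)

Section Averaging.
Variables (R : realDomainType) (I : eqType) (pr : I -> R).
Hypothesis pr01 : forall i, 0 <= pr i <= 1.
Implicit Types (x y : I -> bool) (f g : (I -> bool) -> R) (J : seq I)
  (D : pred I).

Definition update x (j : I) (b : bool) : I -> bool :=
  fun i => if i == j then b else x i.

Definition avg1 (j : I) g : (I -> bool) -> R :=
  fun x => pr j * g (update x j true) + (1 - pr j) * g (update x j false).

(** With [x] giving the coordinates outside [J], this is the conditional
    expectation of [g] given those coordinates, for independent coordinates of
    success probabilities [pr]. *)
Definition avg (J : seq I) g : (I -> bool) -> R := foldr avg1 g J.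

Definition supported (V : Type) D (f : (I -> bool) -> V) :=
  forall x y, (forall i, D i -> x i = y i) -> f x = f y.

Lemma avg_cat J J' g : avg (J ++ J') g = avg J (avg J' g).
Proof. by rewrite /avg foldr_cat. Qed.

(** Only the labellings that agree with [x] off [J] contribute to [avg J g x];
    this is how known labels of earlier generations enter an estimate. *)
Lemma le_avg J f g x :
  (forall y, (forall i, i \notin J -> y i = x i) -> f y <= g y) ->
  avg J f x <= avg J g x.
Proof.
elim: J x => [|j J IH] x fg /=; first by apply: fg.
have /andP[p0 p1] := pr01 j.
rewrite lerD// ler_wpM2l ?subr_ge0//; apply: IH => y yx; apply: fg => i;
  rewrite inE negb_or => /andP[ij iJ]; by rewrite yx// /update (negbTE ij).
Qed.

Lemma eq_avg J f g x :
  (forall y, (forall i, i \notin J -> y i = x i) -> f y = g y) ->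
  avg J f x = avg J g x.
Proof. by move=> fg; apply/le_anti/andP; split; apply: le_avg => y /fg ->. Qed.

Lemma avg_cst J (c : R) x : avg J (fun=> c) x = c.
Proof.
elim: J x => [//|j J IH] x /=; rewrite /avg1 !IH; ring.
Qed.

Lemma avgD J f g x : avg J (fun y => f y + g y) x = avg J f x + avg J g x.
Proof. elim: J x => [//|j J IH] x /=; rewrite /avg1 !IH; ring. Qed.

Lemma avgZ J (c : R) g x : avg J (fun y => c * g y) x = c * avg J g x.
Proof. elim: J x => [//|j J IH] x /=; rewrite /avg1 !IH; ring. Qed.

Lemma avg_sum (L : Type) (r : seq L) (P : pred L) (F : L -> (I -> bool) -> R)
    J x :
  avg J (fun y => \sum_(l <- r | P l) F l y) x =
  \sum_(l <- r | P l) avg J (F l) x.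
Proof.
elim: r => [|l r IH].
  rewrite big_nil -[RHS](avg_cst J 0 x); apply: eq_avg => y _.
  by rewrite big_nil.
rewrite big_cons -IH; case: ifP => Pl; last first.
  by apply: eq_avg => y _; rewrite big_cons Pl.
by rewrite -avgD; apply: eq_avg => y _; rewrite big_cons Pl.
Qed.

Lemma supported_avg D J g : supported D g -> supported D (avg J g).
Proof.
elim: J => [//|j J IH] Dg x y xy /=.
have e b : avg J g (update x j b) = avg J g (update y j b).
  by apply: IH => // i Di; rewrite /update xy.
by rewrite /avg1 !e.
Qed.

Lemma update_out D j b g x : supported D g -> ~~ D j -> g (update x j b) = g x.
Proof.
move=> Dg Dj; apply: Dg => i Di; rewrite /update.
by case: eqP Dj => // <-; rewrite Di.
Qed.

(** Independence: no single coordinate influences both factors, so at each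
    coordinate one of them can be taken out of the average. *)
Lemma avgM D D' J f g x : supported D f -> supported D' g ->
  (forall i, D i -> ~~ D' i) ->
  avg J (fun y => f y * g y) x = avg J f x * avg J g x.
Proof.
move=> Df Dg DD'; elim: J x => [//|j J IH] x /=.
rewrite /avg1 !IH.
have Df' := supported_avg J Df; have Dg' := supported_avg J Dg.
have [Dj|nDj] := boolP (D j).
  by rewrite !(update_out _ _ Dg' (DD' _ Dj)); ring.
by rewrite !(update_out _ _ Df' nDj); ring.
Qed.

Lemma avg_prod (L : eqType) (r : seq L) (D : L -> pred I)
    (F : L -> (I -> bool) -> R) J x :
  uniq r -> {in r, forall l, supported (D l) (F l)} ->
  {in r &, forall l l', l != l' -> forall i, D l i -> ~~ D l' i} ->
  avg J (fun y => \prod_(l <- r) F l y) x = \prod_(l <- r) avg J (F l) x.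
Proof.
elim: r => [|l r IH] /=.
  move=> _ _ _; rewrite big_nil -[RHS](avg_cst J 1 x).
  by apply: eq_avg => y _; rewrite big_nil.
move=> /andP[lr ur] DF disj; rewrite big_cons -IH//; first last.
- by move=> a b ar br; apply: disj; rewrite inE ?ar ?br orbT.
- by move=> a ar; apply: DF; rewrite inE ar orbT.
rewrite -(@avgM (D l) (fun i => has (fun a => D a i) r)).
- by apply: eq_avg => y _; rewrite big_cons.
- by apply: DF; rewrite mem_head.
- move=> y z yz; apply: eq_big_seq => a ar.
  apply: DF; first by rewrite inE ar orbT.
  by move=> i Di; apply: yz; apply/hasP; exists a.
- move=> i Di; apply/hasPn => a ar; apply: (disj l a) Di.
  + by rewrite mem_head.
  + by rewrite inE ar orbT.
  + by apply: contraNneq lr => ->.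
Qed.

(** Averaging a coordinate twice is the same as averaging it once, so [J] may
    have repetitions. *)
Lemma avg_coord J j x : j \in J -> avg J (fun y => (y j)%:R) x = pr j.
Proof.
elim: J x => [//|k J IH] x; rewrite inE => /orP[/eqP <-|jJ] /=; last first.
  by rewrite /avg1 !IH//; ring.
have [jJ|njJ] := boolP (j \in J); first by rewrite /avg1 !IH//; ring.
have H z : avg J (fun y => (y j)%:R) z = (z j)%:R.
  rewrite -[RHS](avg_cst J ((z j)%:R) z); apply: eq_avg => y yz.
  by rewrite yz.
rewrite /avg1 !H /update eqxx /=; ring.
Qed.

End Averaging.

(** * The law of an event determined by finitely many labels *)

Section Law.
Variables (R : realType) (I : eqType) (pr : I -> R).
Variables (d : measure_display) (T : measurableType d).
Variables (Q : {measure set T -> \bar R}) (Y : T -> I -> bool).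
Implicit Types (K J : seq I) (b : I -> bool).

Definition cylinder K b : set T := [set w | {in K, forall i, Y w i = b i}].

Definition cylinder_prob K b : R :=
  \prod_(i <- K) (if b i then pr i else 1 - pr i).

Hypothesis mY : forall i c, measurable [set w | Y w i = c].
Hypothesis QY : forall K b, uniq K -> Q (cylinder K b) = (cylinder_prob K b)%:E.

Lemma cylinder_cons j K b c : j \notin K ->
  cylinder (j :: K) (update b j c) = [set w | Y w j = c] `&` cylinder K b.
Proof.
move=> jK; apply/seteqP; split => w /=.
  move=> H; split; first by rewrite H ?mem_head// /update eqxx.
  move=> i iK; rewrite H ?inE ?iK ?orbT// /update.
  by case: eqP iK jK => // -> ->.
move=> [jc H] i; rewrite inE /update; case: eqP => [->//|_ /= iK].
exact: H.
Qed.

Lemma cylinder_prob_cons j K b c : j \notin K ->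
  cylinder_prob (j :: K) (update b j c) =
  (if c then pr j else 1 - pr j) * cylinder_prob K b.
Proof.
move=> jK; rewrite /cylinder_prob big_cons /update eqxx; congr (_ * _).
by apply: eq_big_seq => i iK; case: eqP iK jK => // -> ->.
Qed.

Lemma measurable_cylinder K b : measurable (cylinder K b).
Proof.
elim: K => [|j K IH].
  by rewrite (_ : cylinder _ _ = setT)//; apply/seteqP; split.
rewrite (_ : cylinder _ _ = [set w | Y w j = b j] `&` cylinder K b).
  by apply: measurableI => //; exact: mY.
apply/seteqP; split => w /=.
  move=> H; split; first by rewrite H ?mem_head.
  by move=> i iK; rewrite H ?inE ?iK ?orbT.
by move=> [jc H] i; rewrite inE => /orP[/eqP ->//|]; exact: H.
Qed.

(** Splitting on the value of one more coordinate of [J] moves it from [J] into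
    the cylinder, and mirrors the recursive definition of [avg]; when [J] is
    exhausted, [A] is constant on the cylinder. *)
Lemma cylinder_law J K b (A : (I -> bool) -> bool) :
  uniq (K ++ J) -> supported (mem (K ++ J)) A ->
  measurable (cylinder K b `&` [set w | A (Y w)]) /\
  Q (cylinder K b `&` [set w | A (Y w)]) =
  (cylinder_prob K b * avg pr J (fun y => (A y)%:R) b)%:E.
Proof.
elim: J K b => [|j J IH] K b.
  rewrite cats0 => uK sA /=.
  have Ab w : cylinder K b w -> A (Y w) = A b.
    by move=> cw; apply: sA => i /cw.
  case: (boolP (A b)) => hA.
    rewrite (_ : _ `&` _ = cylinder K b); last first.
      apply/seteqP; split => w /=; first by case.
      by move=> cw; split => //; rewrite Ab.
    by rewrite QY// mulr1; split => //; exact: measurable_cylinder.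
  rewrite (_ : _ `&` _ = set0); last first.
    by apply/seteqP; split => w //= [cw]; rewrite Ab// (negbTE hA).
  by rewrite mulr0 measure0; split.
have E : perm_eq ((j :: K) ++ J) (K ++ j :: J) 
  by apply/permPl; exact: (perm_catCA [:: j] K J).
move=> u s.
have u' : uniq ((j :: K) ++ J) by rewrite (perm_uniq E).
have s' : supported (mem ((j :: K) ++ J)) A.
  by move=> x y xy; apply: s => i /= iK; apply: xy; rewrite /= (perm_mem E).
have jK : j \notin K by move: u'; rewrite /= mem_cat negb_or -andbA => /andP[].
have [m1 q1] := IH _ (update b j true) u' s'.
have [m2 q2] := IH _ (update b j false) u' s'.
have -> : cylinder K b `&` [set w | A (Y w)] =
    (cylinder (j :: K) (update b j true) `&` [set w | A (Y w)]) `|`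
    (cylinder (j :: K) (update b j false) `&` [set w | A (Y w)]).
  rewrite !cylinder_cons//; apply/seteqP; split => w /=.
    by move=> [cw Aw]; case: (Y w j); [left|right].
  by move=> [[[_ ?] ?]|[[_ ?] ?]].
split; first exact: measurableU.
rewrite measureU//; last first.
  rewrite !cylinder_cons//; apply/seteqP; split => w //=.
  by move=> [[[-> _] _] [[]]].
transitivity ((cylinder_prob (j :: K) (update b j true) *
    avg pr J (fun y => (A y)%:R) (update b j true))%:E +
  (cylinder_prob (j :: K) (update b j false) *
    avg pr J (fun y => (A y)%:R) (update b j false))%:E)%E.
  by congr (_ + _)%E; [exact: q1 | exact: q2].
rewrite !cylinder_prob_cons//= -EFinD; congr (_%:E).
by rewrite /avg1; ring.
Qed.

Lemma event_law J (A : (I -> bool) -> bool) b :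
  uniq J -> supported (mem J) A ->
  measurable [set w | A (Y w)] /\
  Q [set w | A (Y w)] = (avg pr J (fun y => (A y)%:R) b)%:E.
Proof.
move=> uJ sA; have := @cylinder_law J [::] b A uJ sA.
have -> : cylinder [::] b = setT by apply/seteqP; split.
by rewrite setTI /cylinder_prob big_nil mul1r.
Qed.

End Law.

(** * Words, their positions, and counts of surviving pairs *)

Section Words.
Variable M : nat.
Implicit Types (s t : seq 'I_M) (st : seq 'I_M * seq 'I_M)
  (y : bool * seq 'I_M -> bool).

(** Words are extended on the right because a child of a word appends a digit. *)
Fixpoint words n : seq (seq 'I_M) :=
  if n is n'.+1 then [seq rcons s i | s <- words n', i <- enum 'I_M]
  else [:: [::]].

Lemma mem_words n s : (s \in words n) = (size s == n).
Proof.
elim: n s => [|n IH] s /=; first by rewrite inE; case: s.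
apply/allpairsP/idP => [[[u i] [/= uw _ ->]]|].
  by rewrite size_rcons eqSS -IH.
case/lastP: s => [//|s i]; rewrite size_rcons eqSS -IH => sw.
by exists (s, i); rewrite mem_enum.
Qed.

Lemma size_words n : size (words n) = (M ^ n)%N.
Proof.
elim: n => [//|n IH] /=.
by rewrite size_allpairs IH size_enum_ord expnSr.
Qed.

Lemma words_uniq n : uniq (words n).
Proof.
elim: n => [//|n IH] /=; apply: allpairs_uniq => //; first exact: enum_uniq.
by move=> [s i] [t j] _ _ /= /rcons_inj[-> ->].
Qed.

(** The index of the M-adic interval of a word [s] among the [M ^ size s]
    intervals of its generation, in increasing order. *)
Definition position (s : seq 'I_M) : nat :=
  foldl (fun (a : nat) (i : 'I_M) => a * M + i)%N 0%N s.

Lemma position_rcons s i : position (rcons s i) = (position s * M + i)%N.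
Proof. by rewrite /position -cats1 foldl_cat. Qed.

Lemma position_inj n : {in words n &, injective position}.
Proof.
elim: n => [|n IH] s t /=; first by rewrite !inE => /eqP -> /eqP ->.
move=> /allpairsP[[u i] [/= uw _ ->]] /allpairsP[[v j] [/= vw _ ->]].
rewrite !position_rcons => e.
have ltM := ltn_ord i; have ltM' := ltn_ord j.
have M0 : (0 < M)%N by apply: leq_ltn_trans ltM.
have /IH e1 : position u = position v.
  have := congr1 (fun a => a %/ M)%N e.
  by rewrite /= !divnMDl// !divn_small// !addn0.
rewrite e1//; congr rcons; apply: ord_inj.
by move: e; rewrite e1// => /addnI.
Qed.

(** The root label is not tested. The boolean [b] selects the tree: [false] for
    the subtracted set, [true] for the other. *)
Definition alive y (b : bool) s : bool :=
  all (fun k => y (b, take k s)) (iota 1 (size s)).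

Lemma alive_rcons y b s i :
  alive y b (rcons s i) = alive y b s && y (b, rcons s i).
Proof.
rewrite /alive size_rcons -[X in iota _ X]addn1 iotaD all_cat /= andbT; congr (_ && _).
  apply: eq_in_all => k; rewrite mem_iota => /andP[k1].
  by rewrite addnC addn1 ltnS => ks; rewrite -cats1 takel_cat.
by rewrite addnC addn1 take_oversize// size_rcons.
Qed.

Definition level n : seq (bool * seq 'I_M) :=
  [seq (b, s) | b <- [:: false; true], s <- words n].

Lemma mem_level n b s : ((b, s) \in level n) = (size s == n).
Proof.
rewrite -mem_words; apply/allpairsP/idP => [[[c u] [/= _ uw [_ ->]]]//|sw].
by exists (b, s); split => //=; rewrite !inE; case: b.
Qed.

Lemma level_uniq n : uniq (level n).
Proof.
by apply: allpairs_uniq; rewrite ?words_uniq// => -[? ?] [? ?].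
Qed.

Lemma eq_alive y y' b s :
  (forall u, (0 < size u <= size s)%N -> y (b, u) = y' (b, u)) ->
  alive y b s = alive y' b s.
Proof.
move=> yy'; apply: eq_in_all => k; rewrite mem_iota => /andP[k1 ks].
apply: yy'; rewrite size_take; case: (ltnP k) => sk; first by rewrite k1 ltnW.
by rewrite leqnn andbT (leq_trans k1).
Qed.

Definition pairs n := [seq (s, t) | s <- words n, t <- words n].

Lemma mem_pairs n s t :
  ((s, t) \in pairs n) = (size s == n) && (size t == n).
Proof.
rewrite -!mem_words; apply/allpairsP/andP => [[[u v] [/= ? ? [-> ->]]]|[? ?]] //.
by exists (s, t).
Qed.

Lemma pairs_uniq n : uniq (pairs n).
Proof. by apply: allpairs_uniq; rewrite ?words_uniq// => -[? ?] [? ?]. Qed.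

(** The difference set of the two intervals coded by a pair has midpoint
    [offset st] in units of their length. *)
Definition offset st : int := (position st.2)%:Z - (position st.1)%:Z.

Definition alive2 y st : bool := alive y false st.1 && alive y true st.2.

Definition pair_count y n (c : int) : nat :=
  count (fun st => alive2 y st && (offset st == c)) (pairs n).

(** Only the new labels are tested: survival of the parents is tested
    separately, which keeps generations independent. *)
Definition children y st (z : int) : nat :=
  (\sum_(i < M) \sum_(j < M | ((j : nat)%:Z - (i : nat)%:Z == z)%R)
     (y (false, rcons st.1 i) && y (true, rcons st.2 j)))%N.

Lemma offset_rcons s t i j :
  offset (rcons s i, rcons t j) =
  M%:Z * offset (s, t) + ((j : nat)%:Z - (i : nat)%:Z).
Proof. by rewrite /offset !position_rcons /=; lia. Qed.

Lemma pair_count_succ y n c :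
  pair_count y n.+1 c =
  (\sum_(st <- pairs n | alive2 y st) children y st (c - M%:Z * offset st)%R)%N.
Proof.
rewrite /pair_count -sum1_count big_mkcond /= big_allpairs /= big_allpairs_dep /=.
rewrite [RHS]big_mkcond big_allpairs; apply: eq_bigr => s _.
rewrite big_enum /=.
under eq_bigr do rewrite big_allpairs_dep.
rewrite exchange_big; apply: eq_bigr => t _ /=.
under eq_bigr do rewrite big_enum /=.
rewrite /alive2 /=; case: ifP => al; last first.
  rewrite big1// => i _; rewrite big1// => j _.
  rewrite !alive_rcons; case: ifP => // /andP[/andP[/andP[a1 _] /andP[a2 _]] _].
  by rewrite a1 a2 in al.
apply: eq_bigr => i _; rewrite [RHS]big_mkcond; apply: eq_bigr => j _.
move: al => /andP[a1 a2]; rewrite !alive_rcons a1 a2 /= offset_rcons.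
have -> : (M%:Z * offset (s, t) + ((j : nat)%:Z - (i : nat)%:Z) == c) =
  ((j : nat)%:Z - (i : nat)%:Z == c - M%:Z * offset (s, t) :> int).
  by apply/eqP/eqP; lia.
by case: ifP => [/andP[-> ->]//|]; case: ifP => // _; rewrite andbT => ->.
Qed.

Lemma children_out y st z : (M%:Z <= z) || (z <= - M%:Z) -> children y st z = 0%N.
Proof.
move=> zM; rewrite /children big1// => i _; rewrite big1// => j /eqP ij.
by have := ltn_ord i; have := ltn_ord j; lia.
Qed.

(** Digit differences lie strictly between [-M] and [M], so only parents at offset
    [c] or [c + 1] have children at offset [M * c + k]. For [k = M] the first sum
    vanishes: both ends of a block of offsets obey the same formula. *)
Lemma pair_count_step y n c k : (k <= M)%N ->
  pair_count y n.+1 (M%:Z * c + k%:Z) =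
  (\sum_(st <- pairs n | alive2 y st && (offset st == c))
     children y st k%:Z +
   \sum_(st <- pairs n | alive2 y st && (offset st == (c + 1)%R))
     children y st (k%:Z - M%:Z)%R)%N.
Proof.
move=> kM; rewrite pair_count_succ.
rewrite [LHS]big_mkcond [X in (X + _)%N]big_mkcond [X in (_ + X)%N]big_mkcond.
rewrite -big_split; apply: eq_bigr => st _ /=; case: (alive2 y st) => //=.
have [->|nc] := eqVneq (offset st) c.
  rewrite ifF ?addn0; last by apply/negbTE/eqP; lia.
  by congr children; lia.
have [->|nc1] := eqVneq (offset st) (c + 1).
  by rewrite add0n; congr children; lia.
rewrite addn0 children_out//; apply/orP.
move: (offset st) nc nc1 => e /eqP nc /eqP nc1.
have M0 : 0 <= M%:Z by [].
have [lt|gt] := lerP e c; [left|right].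
  have : 0 <= M%:Z * (c - 1 - e) by apply: mulr_ge0 => //; lia.
  by lia.
have : 0 <= M%:Z * (e - c - 2) by apply: mulr_ge0 => //; lia.
by lia.
Qed.

End Words.

(** * One generation: expectation and large deviations *)

Section OneStep.
Variables (R : realType) (M : nat) (p : 'I_M -> R).
Hypothesis p01 : forall i, 0 <= p i <= 1.
Implicit Types (s t : seq 'I_M) (st : seq 'I_M * seq 'I_M)
  (x y : bool * seq 'I_M -> bool).

(** The root label is almost surely 1, which is the value given to it here. *)
Definition label_prob (bs : bool * seq 'I_M) : R :=
  if bs.2 is i :: s then p (last i s) else 1.

Lemma label_prob_rcons b s i : label_prob (b, rcons s i) = p i.
Proof. by case: s => [//|j s] /=; rewrite /label_prob /= last_rcons. Qed.

Lemma label_prob01 bs : 0 <= label_prob bs <= 1.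
Proof. by case: bs => b [|i s]; rewrite /label_prob //= ler01 lexx. Qed.

Definition digit_correlation (z : int) : R :=
  \sum_(i < M) \sum_(j < M | (j : nat)%:Z - (i : nat)%:Z == z) p i * p j.

(** For each [i], the cyclic shift of [i] by [k] is the only [j] with [j - i = k]
    or [j - i = k - M], according to whether it wraps around. *)
Lemma digit_correlation_cyclic k : (k <= M)%N ->
  digit_correlation k%:Z + digit_correlation (k%:Z - M%:Z) =
  cyclic_autocorrelation p k.
Proof.
move=> kM; rewrite /digit_correlation -big_split; apply: eq_bigr => i _ /=.
have iM := ltn_ord i.
have [lt|ge] := ltnP (i + k) M.
  rewrite [X in _ + X]big1 => [|j /eqP]; last by have := ltn_ord j; lia.
  rewrite addr0 (big_pred1 (cyclic_shift i k))// => j /=.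
  apply/eqP/eqP => [e|->]; last by rewrite /= modn_small//; lia.
  by apply/val_inj; rewrite /= modn_small//; lia.
rewrite [X in X + _]big1 => [|j /eqP]; last by have := ltn_ord j; lia.
have E : ((i + k) %% M = i + k - M)%N.
  have {1}-> : (i + k = (i + k - M) + M)%N by lia.
  by rewrite modnDr modn_small//; lia.
rewrite add0r (big_pred1 (cyclic_shift i k))// => j /=.
apply/eqP/eqP => [e|->]; last by rewrite /= E; lia.
by apply/val_inj; rewrite /= E; lia.
Qed.

Lemma avg_children n s t z x : size s = n -> size t = n ->
  avg label_prob (level M n.+1) (fun y => (children y (s, t) z)%:R) x =
  digit_correlation z.
Proof.
move=> sn tn; transitivity (avg label_prob (level M n.+1)
   (fun y => \sum_(i < M) \sum_(j < M | (j : nat)%:Z - (i : nat)%:Z == z)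
     ((y (false, rcons s i))%:R * (y (true, rcons t j))%:R)) x).
  apply: (eq_avg label_prob01) => y _; rewrite /children natr_sum.
  apply: eq_bigr => i _; rewrite natr_sum; apply: eq_bigr => j _ /=.
  by rewrite -natrM mulnb.
rewrite (avg_sum label_prob01); apply: eq_bigr => i _.
rewrite (avg_sum label_prob01); apply: eq_bigr => j _.
rewrite (@avgM _ _ _ (pred1 (false, rcons s i)) (pred1 (true, rcons t j))).
- by rewrite !(avg_coord label_prob01) ?mem_level ?size_rcons ?sn ?tn//
    !label_prob_rcons.
- by move=> a b ab; rewrite ab//= eqxx.
- by move=> a b ab; rewrite ab//= eqxx.
- by move=> a /= /eqP ->.
Qed.

Lemma eq_alive2 x y n st : (forall i, i \notin level M n.+1 -> y i = x i) ->
  st \in pairs M n -> alive2 y st = alive2 x st.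
Proof.
case: st => s t yx; rewrite mem_pairs => /andP[/eqP sn /eqP tn].
by congr (_ && _); apply: eq_alive => u /= us; apply: yx;
  rewrite mem_level; lia.
Qed.

(** The mean recursion: conditionally on the labels up to generation [n], the
    counts at [c] and [c + 1] determine the expected counts in the subcolumns
    of [c] linearly. *)
Lemma avg_pair_count n c k x : (k <= M)%N ->
  avg label_prob (level M n.+1)
    (fun y => (pair_count y n.+1 (M%:Z * c + k%:Z))%:R) x =
  digit_correlation k%:Z * (pair_count x n c)%:R +
  digit_correlation (k%:Z - M%:Z) * (pair_count x n (c + 1))%:R.
Proof.
move=> kM; pose B c' y z : R :=
  \sum_(st <- pairs M n | alive2 x st && (offset st == c')) (children y st z)%:R.
transitivity (avg label_prob (level M n.+1)
  (fun y => B c y k%:Z + B (c + 1) y (k%:Z - M%:Z)) x).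
  apply: (eq_avg label_prob01) => y yx.
  rewrite pair_count_step// natrD !natr_sum.
  congr (_ + _); rewrite big_seq_cond [RHS]big_seq_cond;
  apply: eq_bigl => st; case: (boolP (st \in _)) => //= sp;
  by rewrite (eq_alive2 yx).
have avgB c' z : avg label_prob (level M n.+1) (fun y => B c' y z) x =
    digit_correlation z * (pair_count x n c')%:R.
  rewrite (avg_sum label_prob01) /pair_count -sum1_count natr_sum mulr_sumr.
  rewrite big_seq_cond [RHS]big_seq_cond; apply: eq_bigr => -[s t].
  rewrite mem_pairs mulr1 => /andP[/andP[/eqP sn /eqP tn] _].
  exact: avg_children.
by rewrite avgD !avgB.
Qed.

Definition child_labels st : pred (bool * seq 'I_M) := fun bs =>
  [exists i, bs == (false, rcons st.1 i)] ||
  [exists i, bs == (true, rcons st.2 i)].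

Lemma supported_children st z :
  supported (child_labels st) (fun y => children y st z).
Proof.
move=> x y xy; apply: eq_bigr => i _; apply: eq_bigr => j _; rewrite !xy//.
  by apply/orP; right; apply/existsP; exists j.
by apply/orP; left; apply/existsP; exists i.
Qed.

Lemma children_le y st z : (children y st z <= M ^ 2)%N.
Proof.
rewrite /children; apply: (@leq_trans (\sum_(i < M) \sum_(j < M) 1)%N).
  apply: leq_sum => i _; rewrite big_mkcond; apply: leq_sum => j _.
  by case: ifP => // _; case: (_ && _).
by rewrite sum_nat_const sum1_card !card_ord.
Qed.

(** From [expR u >= 1 + u] and [(1 - u + u ^+ 2) * (1 + u) = 1 + u ^+ 3]. *)
Lemma expRN_le (u : R) : 0 <= u -> expR (- u) <= 1 - u + u ^+ 2.
Proof.
move=> u0; rewrite expRN -[leLHS]mul1r ler_pdivrMr ?expR_gt0//.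
have u1 : 0 <= 1 - u + u ^+ 2 by nra.
apply: le_trans (ler_wpM2l u1 (expR_ge1Dx u)).
by have := exprn_ge0 3 u0; nra.
Qed.

Lemma avg_expR_children n s t z x theta : size s = n -> size t = n ->
  0 <= theta ->
  avg label_prob (level M n.+1)
    (fun y => expR (- (theta * (children y (s, t) z)%:R))) x <=
  expR (theta ^+ 2 * M%:R ^+ 4 - theta * digit_correlation z).
Proof.
move=> sn tn th0; apply: le_trans (expR_ge1Dx _).
have -> : 1 + (theta ^+ 2 * M%:R ^+ 4 - theta * digit_correlation z) =
  avg label_prob (level M n.+1) (fun y => (1 + theta ^+ 2 * M%:R ^+ 4) +
    - theta * (children y (s, t) z)%:R) x.
  by rewrite avgD avgZ avg_cst avg_children//; ring.
apply: (le_avg label_prob01) => y _.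
set c := (children _ _ _); have cM : c%:R <= M%:R ^+ 2 :> R.
  by rewrite -natrX ler_nat children_le.
apply: le_trans (expRN_le _) _; first by rewrite mulr_ge0.
have : (c%:R : R) ^+ 2 <= M%:R ^+ 4.
  have -> : M%:R ^+ 4 = (M%:R ^+ 2) ^+ 2 :> R by rewrite -exprM.
  by rewrite lerXn2r ?nnegrE ?exprn_ge0.
move=> c2; have := ler_wpM2l (sqr_ge0 theta) c2.
by rewrite exprMn; lra.
Qed.

(** The Chernoff bound for the total number of children. Distinct parents of the
    list share no word in either tree, so their numbers of children depend on
    disjoint sets of labels and the exponential moments multiply. *)
Lemma chernoff n (L : seq (seq 'I_M * seq 'I_M)) z x eps theta :
  {subset L <= pairs M n} -> uniq L ->
  {in L &, injective fst} -> {in L &, injective snd} -> 0 <= theta ->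
  avg label_prob (level M n.+1)
    (fun y => ((\sum_(st <- L) children y st z)%N%:R <
               (size L)%:R * (digit_correlation z - eps))%R%:R) x <=
  expR (theta ^+ 2 * M%:R ^+ 4 - theta * eps) ^+ size L.
Proof.
move=> Ln uL i1 i2 th0.
(* Markov inequality for the exponential moment. *)
pose G y := expR ((size L)%:R * (theta * (digit_correlation z - eps))) *
  \prod_(st <- L) expR (- (theta * (children y st z)%:R)).
apply: (@le_trans _ _ (avg label_prob (level M n.+1) G x)).
  apply: (le_avg label_prob01) => y _; rewrite /G -expR_sum -expRD.
  case: ltP => [lt|_] /=; last exact: expR_ge0.
  rewrite -[leLHS]expR0 ler_expR sumrN -mulr_sumr -natr_sum.
  rewrite mulrCA -mulrBr mulr_ge0// subr_ge0; exact: ltW.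
rewrite avgZ (@avg_prod _ _ _ label_prob01 _ _ child_labels)//; first last.
- move=> st st' m m' /eqP ne [b u] /orP[] /existsP[i /eqP[-> ->]];
  rewrite /child_labels negb_or; apply/andP; split; apply/existsPn => j;
  apply/eqP => // -[/rcons_inj[e _]]; apply: ne.
    exact: i1.
  exact: i2.
- by move=> st _ a b ab; rewrite (supported_children z ab).
rewrite expRM_natl.
apply: (@le_trans _ _ (expR (theta * (digit_correlation z - eps)) ^+ size L *
   \prod_(st <- L) expR (theta ^+ 2 * M%:R ^+ 4 - theta * digit_correlation z))).
  rewrite ler_wpM2l ?exprn_ge0 ?expR_ge0// big_seq [leRHS]big_seq.
  apply: ler_prod => -[s t] stL.
  have /Ln := stL; rewrite mem_pairs => /andP[/eqP sn /eqP tn].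
  rewrite avg_expR_children// -(avg_cst label_prob (level M n.+1) 0 x).
  by rewrite (le_avg label_prob01)// => y _; exact: expR_ge0.
rewrite big_const_seq count_predT iter_mulr_1 -exprMn -expRD.
by rewrite le_eqVlt; apply/orP; left; apply/eqP; congr (expR _ ^+ _); ring.
Qed.

(** Parents at [c] and at [c + 1] may share a word, so they are not independent of
    each other. The deficit is therefore split between the two classes, each of
    which is handled by [chernoff] on exactly [h] parents. *)
Lemma avg_pair_count_small n c k h x (b eps theta : R) : (k <= M)%N ->
  (h <= pair_count x n c)%N -> (h <= pair_count x n (c + 1))%N -> 0 <= theta ->
  b <= h%:R * (cyclic_autocorrelation p k - 2 * eps) ->
  avg label_prob (level M n.+1)
    (fun y => ((pair_count y n.+1 (M%:Z * c + k%:Z))%:R < b)%R%:R) x <=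
  2 * expR (theta ^+ 2 * M%:R ^+ 4 - theta * eps) ^+ h.
Proof.
move=> kM h1 h2 th0 hb.
pose L c' := take h [seq st <- pairs M n | alive2 x st && (offset st == c')].
have subL c' : {subset L c' <= pairs M n}.
  by move=> st /mem_take; rewrite mem_filter => /andP[].
have offL c' st : st \in L c' -> offset st = c'.
  by move=> /mem_take; rewrite mem_filter => /andP[/andP[_ /eqP]].
have uL c' : uniq (L c') by rewrite take_uniq// filter_uniq// pairs_uniq.
have i1 c' : {in L c' &, injective fst}.
  move=> [s t] [s' t'] m m' /= ss; subst s'; congr (_, _).
  have := offL _ _ m'; rewrite -(offL _ _ m) /offset /= => e.
  have := subL _ _ m; have := subL _ _ m'; rewrite !mem_pairs -!mem_words.
  move=> /andP[_ t'n] /andP[_ tn]; apply: (position_inj tn t'n).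
  by lia.
have i2 c' : {in L c' &, injective snd}.
  move=> [s t] [s' t'] m m' /= ss; subst t'; congr (_, _).
  have := offL _ _ m'; rewrite -(offL _ _ m) /offset /= => e.
  have := subL _ _ m; have := subL _ _ m'; rewrite !mem_pairs -!mem_words.
  move=> /andP[t'n _] /andP[tn _]; apply: (position_inj tn t'n).
  by lia.
have sL c' : (h <= pair_count x n c')%N -> size (L c') = h.
  by move=> hc; rewrite size_takel// size_filter.
pose W c' z y : R := (\sum_(st <- L c') children y st z)%N%:R.
pose S c' z y : bool := W c' z y < h%:R * (digit_correlation z - eps).
apply: (@le_trans _ _ (avg label_prob (level M n.+1) (fun y =>
   (S c k%:Z y)%:R + (S (c + 1) (k%:Z - M%:Z) y)%:R) x)).
  apply: (le_avg label_prob01) => y yx.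
  case: ltP => [lt|_] /=; last by rewrite addr_ge0.
  rewrite /S; case: ltP => [_|le1] /=; first by rewrite lerDl.
  case: ltP => [_|le2] /=; first by rewrite lerDr.
  exfalso; move: lt; apply/negP; rewrite -leNgt.
  apply: (le_trans hb); rewrite -digit_correlation_cyclic//.
  apply: (@le_trans _ _ (W c k%:Z y + W (c + 1) (k%:Z - M%:Z) y)); first lra.
  rewrite -natrD ler_nat pair_count_step//.
  have sub c' z : (\sum_(st <- L c') children y st z <=
    \sum_(st <- pairs M n | alive2 y st && (offset st == c'))
       children y st z)%N.
    apply: (@leq_trans (\sum_(st <- [seq st <- pairs M n |
        alive2 x st && (offset st == c')]) children y st z)%N).
      rewrite /L -[X in (_ <= \sum_(_ <- X) _)%N](cat_take_drop h) big_cat.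
      exact: leq_addr.
    rewrite big_filter big_seq_cond [leqRHS]big_seq_cond leq_eqVlt.
    apply/orP; left; apply/eqP; apply: eq_bigl => st.
    case: (boolP (st \in pairs M n)) => //= sp.
    by rewrite (eq_alive2 yx).
  exact: leq_add.
rewrite avgD mulr_natl mulr2n; apply: lerD.
  by have := @chernoff n (L c) k%:Z x eps theta; rewrite sL//; apply.
by have := @chernoff n (L (c + 1)) (k%:Z - M%:Z) x eps theta; rewrite sL//; apply.
Qed.

End OneStep.

(** * Blocks of columns that stay populated *)

Section Levels.
Variable M : nat.

(** The labels of generations [n + 1] to [n + m], the last generation being
    averaged first by [avg]. *)
Fixpoint levels n m : seq (bool * seq 'I_M) :=
  if m is m'.+1 then levels n m' ++ level M (n + m').+1 else [::].

Lemma mem_levels n m (b : bool) (s : seq 'I_M) :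
  ((b, s) \in levels n m) = (n < size s <= n + m)%N.
Proof.
elim: m => [|m IH] /=; first by rewrite in_nil; lia.
by rewrite mem_cat IH mem_level; lia.
Qed.

Lemma levels_uniq n m : uniq (levels n m).
Proof.
elim: m => [//|m IH] /=; rewrite cat_uniq IH level_uniq andbT /=.
apply/hasPn => -[b s]; rewrite mem_level mem_levels; lia.
Qed.

Lemma levels_cat n m m' : levels n (m + m') = levels n m ++ levels (n + m) m'.
Proof.
elim: m' => [|m' IH]; first by rewrite addn0 cats0.
by rewrite addnS /= IH catA addnA.
Qed.

(** The offsets from [M ^ m * c] to [M ^ m * (c + 1)], both included, are the
    columns of generation [n + m] inside the column [c] of generation [n],
    together with the right end that the last column needs. *)
Definition segment_ge (y : bool * seq 'I_M -> bool) n c m h : bool :=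
  all (fun k => h <= pair_count y (n + m) ((M ^ m)%N%:Z * c + k%:Z))%N
    (iota 0 (M ^ m).+1).

Definition all_segments_ge (h : nat -> nat) y n c m : bool :=
  all (fun i => segment_ge y n c i (h i)) (iota 0 m.+1).

End Levels.

Section Growth.
Variables (R : realType) (M : nat) (p : 'I_M -> R).
Hypothesis p01 : forall i, 0 <= p i <= 1.
Hypothesis M2 : (2 <= M)%N.
Implicit Types (s t : seq 'I_M) (st : seq 'I_M * seq 'I_M)
  (x y : bool * seq 'I_M -> bool).

Let pr01 := label_prob01 p01.

(** A union bound over the offsets of the next generation, each of which is
    [M * c' + k] with [c'] and [c' + 1] both in the present block. *)
Lemma segment_step n m c h h' (e : R) x :
  (forall k c', (k <= M)%N ->
    (h <= pair_count x (n + m) c')%N -> (h <= pair_count x (n + m) (c' + 1))%N ->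
    avg (label_prob p) (level M (n + m).+1)
      (fun y => ((pair_count y (n + m).+1 (M%:Z * c' + k%:Z))%:R
                 < (h'%:R : R))%R%:R) x <= e) ->
  segment_ge x n c m h ->
  1 - (M ^ m.+1).+1%:R * e <=
  avg (label_prob p) (level M (n + m).+1)
    (fun y => (segment_ge y n c m.+1 h')%:R) x.
Proof.
move=> He /allP H.
pose bad k y : bool :=
  (pair_count y (n + m).+1 ((M ^ m.+1)%N%:Z * c + k%:Z))%:R < (h'%:R : R).
apply: (@le_trans _ _ (avg (label_prob p) (level M (n + m).+1)
  (fun y => 1 + (-1) * \sum_(k <- iota 0 (M ^ m.+1).+1) (bad k y)%:R) x)).
  rewrite avgD avg_cst avgZ mulN1r lerD2l lerN2 (avg_sum pr01).
  rewrite -{2}(size_iota 0 (M ^ m.+1).+1) -sum1_size natr_sum mulr_suml.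
  rewrite big_seq [leRHS]big_seq; apply: ler_sum => k.
  rewrite mem_iota mul1r => /andP[_ kM].
  have M0 : (0 < M)%N by lia.
  (* The predecessor keeps [k' < M ^ m] at the right end, where the remainder is M. *)
  pose k' := (k.-1 %/ M)%N; pose r := (k - M * k')%N.
  have k'M : (k' < M ^ m)%N.
    rewrite /k' ltn_divLR// -expnSr.
    have : (0 < M ^ m.+1)%N by rewrite expn_gt0 M0.
    lia.
  have kE : (k.-1 = k' * M + k.-1 %% M)%N := divn_eq _ _.
  have rlt := ltn_pmod k.-1 M0.
  have rE : (r <= M)%N by rewrite /r; lia.
  have E : (M ^ m.+1)%N%:Z * c + k%:Z = M%:Z * ((M ^ m)%N%:Z * c + k'%:Z) + r%:Z.
    have -> : k = (M * k' + r)%N by rewrite /r; nia.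
    rewrite expnS !PoszD !PoszM; ring.
  rewrite /bad E; apply: He => //.
    by apply: H; rewrite mem_iota; lia.
  have -> : (M ^ m)%N%:Z * c + k'%:Z + 1 = (M ^ m)%N%:Z * c + k'.+1%:Z by lia.
  by apply: H; rewrite mem_iota; lia.
apply: (le_avg pr01) => y _; rewrite mulN1r.
have [ok|/allPn[k ki bk]] := boolP (segment_ge y n c m.+1 h').
  by rewrite lerBlDr lerDl sumr_ge0.
rewrite subr_le0 (big_rem k)//= /bad ltr_nat -addnS -ltnNge in bk *.
by rewrite bk lerDl sumr_ge0.
Qed.

(** The failure probabilities of the successive generations add up, since each
    is a bound given all labels of the previous generations. *)
Lemma all_segments_chance (h : nat -> nat) (e : nat -> R) n c x m :
  (forall m, 0 <= e m) -> (forall m, \sum_(i < m) e i <= 2^-1) ->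
  (forall n m c k x, (k <= M)%N ->
    (h m <= pair_count x n c)%N -> (h m <= pair_count x n (c + 1))%N ->
    avg (label_prob p) (level M n.+1)
      (fun y => ((pair_count y n.+1 (M%:Z * c + k%:Z))%:R
                 < ((h m.+1)%:R : R))%R%:R) x <= e m / (M ^ m.+1).+1%:R) ->
  (segment_ge x n c 0 (h 0%N))%:R * (1 - \sum_(i < m) e i) <=
  avg (label_prob p) (levels M n m)
    (fun y => (all_segments_ge h y n c m)%:R) x.
Proof.
move=> e0 se He; elim: m => [|m IH].
  by rewrite /= big_ord0 subr0 mulr1 /all_segments_ge /= andbT.
rewrite /= avg_cat; apply: (@le_trans _ _ (avg (label_prob p) (levels M n m)
   (fun y => (1 - e m) * (all_segments_ge h y n c m)%:R) x)).
  have := se m.+1; rewrite avgZ big_ord_recr /=.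
  have S0 : 0 <= \sum_(i < m) e i by apply: sumr_ge0.
  have em0 := e0 m; move=> se1.
  apply: le_trans (ler_wpM2l _ IH); last by lra.
  rewrite mulrCA ler_wpM2l//; nra.
apply: (le_avg pr01) => y _.
have fixed z : (forall i, i \notin level M (n + m).+1 -> z i = y i) ->
    all_segments_ge h z n c m = all_segments_ge h y n c m.
  move=> zy; apply: eq_in_all => i; rewrite mem_iota => /andP[_ im].
  apply: eq_all => k; congr (_ <= _)%N.
  apply: eq_in_count => -[s t] /=.
  rewrite mem_pairs => /andP[/eqP sn /eqP tn]; congr (_ && _).
  by congr (_ && _); apply: eq_alive => u /= us; apply: zy;
    rewrite mem_level; lia.
have [ok|_] := boolP (all_segments_ge h y n c m); last first.
  by rewrite mulr0 -(avg_cst (label_prob p) (level M (n + m).+1) 0 y);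
    apply: (le_avg pr01).
have okm : segment_ge y n c m (h m).
  by move/allP: ok; apply; rewrite mem_iota; lia.
rewrite mulr1; apply: (@le_trans _ _ (avg (label_prob p) (level M (n + m).+1)
    (fun y => (segment_ge y n c m.+1 (h m.+1))%:R) y)).
  apply: le_trans (segment_step _ okm); last first.
    by move=> k c' kM h1 h2; apply: He.
  by rewrite mulrCA divff ?mulr1// pnatr_eq0.
apply: (le_avg pr01) => z zy.
rewrite /all_segments_ge -(addn1 m.+1) iotaD all_cat /= andbT add0n.
have := fixed _ zy; rewrite ok /all_segments_ge /= => ->.
by [].
Qed.

End Growth.

Section Thresholds.
Variables (R : realType) (M : nat) (p : 'I_M -> R).
Hypothesis p01 : forall i, 0 <= p i <= 1.
Hypothesis M2 : (2 <= M)%N.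

Lemma common_excess (g : nat -> R) n : (forall k, (k <= n)%N -> 1 < g k) ->
  exists2 e : R, 0 < e & forall k, (k <= n)%N -> 1 + e <= g k.
Proof.
elim: n => [|n IH] g1.
  exists (g 0%N - 1); first by rewrite subr_gt0 g1.
  by move=> k; rewrite leqn0 => /eqP ->; rewrite addrC subrK.
have [|e e0 ge] := IH; first by move=> k kn; apply: g1; apply: leqW.
exists (Num.min e (g n.+1 - 1)); first by rewrite lt_min e0 subr_gt0 g1.
move=> k; rewrite leq_eqVlt => /orP[/eqP ->|kn].
  by rewrite -lerBrDl ge_min lexx orbT.
by apply: le_trans (ge k kn); rewrite lerD2l ge_min lexx.
Qed.

Lemma expr_small (a b : R) : 0 <= a < 1 -> 0 < b -> exists n, a ^+ n <= b.
Proof.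
move=> /andP[a0 a1] b0.
have /cvgrPdist_lt/(_ _ b0)[n _ /(_ n (leqnn n))] : (fun n => a ^+ n) @ \oo --> (0 : R).
  by apply: cvg_expr; rewrite ger0_norm.
by rewrite /= sub0r normrN ger0_norm ?exprn_ge0// => /ltW; exists n.
Qed.

(** The thresholds are [h m = K * (m + s)]. They grow by the factor
    [1 + 1 / (m + s)], which is below every autocorrelation when [s] is large. The
    failure bound is about [M ^ m * tau ^ (K * (m + s))]: the choice of [K] makes
    it geometric with ratio 1/2, that of [s] makes its sum at most 1/2. *)
Lemma growth_thresholds : (forall k, (k <= M)%N -> 1 < cyclic_autocorrelation p k) ->
  exists (h : nat -> nat) (e : nat -> R),
  [/\ forall m, (0 < h m)%N, forall m, 0 <= e m,
    forall m, \sum_(i < m) e i <= 2^-1 &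
    forall n m c k x, (k <= M)%N ->
    (h m <= pair_count x n c)%N -> (h m <= pair_count x n (c + 1))%N ->
    avg (label_prob p) (level M n.+1)
      (fun y => ((pair_count y n.+1 (M%:Z * c + k%:Z))%:R
                 < ((h m.+1)%:R : R))%R%:R) x <= e m / (M ^ m.+1).+1%:R].
Proof.
move=> /common_excess[del del0 gdel].
have M0 : 0 < M%:R :> R by rewrite ltr0n; lia.
have M40 : 0 < M%:R ^+ 4 :> R by rewrite exprn_gt0.
pose eps := del / 4; have eps0 : 0 < eps by rewrite divr_gt0.
(* The minimizer of the exponent [theta ^+ 2 * M%:R ^+ 4 - theta * eps]. *)
pose theta := eps / (2 * M%:R ^+ 4).
have theta0 : 0 < theta by rewrite divr_gt0// mulr_gt0.
pose tau := expR (theta ^+ 2 * M%:R ^+ 4 - theta * eps).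
have tau0 : 0 < tau := expR_gt0 _.
have tau1 : tau < 1.
  rewrite expR_lt1 subr_lt0 expr2 -mulrA ltr_pM2l// /theta.
  rewrite [X in X < _](_ : _ = eps / 2); last by field; rewrite gt_eqF.
  lra.
have [K hK] : exists K, tau ^+ K <= (2 * M%:R)^-1.
  by apply: expr_small; rewrite ?(ltW tau0)// invr_gt0 mulr_gt0.
have K0 : (0 < K)%N.
  case: K hK => // ; rewrite expr0 invf_ge1 ?mulr_gt0// => hM.
  exfalso; have : 2 <= M%:R :> R by rewrite (ler_nat R 2).
  lra.
have [s1 hs1] : exists s1 : nat, del^-1 * 2 <= s1%:R.
  by exists (Num.truncn (del^-1 * 2)).+1; rewrite ltW// truncnS_gt.
pose s := (s1 + 16 * M)%N.
have sdel : 2 <= del * s%:R.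
  rewrite -ler_pdivrMl//; apply: (le_trans hs1).
  by rewrite ler_nat leq_addr.
have s0 : (0 < s)%N by rewrite /s; lia.
have hs : M%:R * (tau ^+ K) ^+ s * 16 <= 1.
  have h1 : (tau ^+ K) ^+ s <= (2^-1) ^+ s.
    rewrite lerXn2r ?nnegrE ?exprn_ge0 ?(ltW tau0)//.
    apply: (le_trans hK); rewrite lef_pV2 ?posrE ?mulr_gt0//.
    by rewrite ler_pMr// ler1n; lia.
  have h2 : 16 * M%:R <= 2 ^+ s :> R.
    rewrite -natrX -natrM ler_nat; apply: (@leq_trans s); first by rewrite /s; lia.
    exact/ltnW/ltn_expl.
  rewrite mulrAC [X in X * _]mulrC; apply: (le_trans (ler_wpM2l _ h1)).
    by rewrite mulr_ge0// ltW.
  by rewrite exprVn ler_pdivrMr ?exprn_gt0// mul1r.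
pose h m := (K * (m + s))%N.
pose e m := (M ^ m.+1).+1%:R * (2 * tau ^+ h m).
have e0 m : 0 <= e m by rewrite !mulr_ge0// exprn_ge0// ltW.
have eM m : e m <= 4^-1 * (2^-1) ^+ m.
  have a1 : (M ^ m.+1).+1%:R <= 2 * M%:R ^+ m.+1 :> R.
    rewrite -natrX -natrM ler_nat.
    have : (0 < M ^ m.+1)%N by rewrite expn_gt0; lia.
    lia.
  apply: (@le_trans _ _ (2 * M%:R ^+ m.+1 * (2 * tau ^+ h m))).
    by rewrite ler_wpM2r// mulr_ge0// exprn_ge0// ltW.
  rewrite /h mulnDr exprD !exprM exprS.
  have b1 : (M%:R * tau ^+ K) ^+ m <= 2^-1 ^+ m.
    rewrite lerXn2r ?nnegrE ?mulr_ge0 ?exprn_ge0 ?(ltW tau0) ?(ltW M0)//.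
    by rewrite -ler_pdivlMl// (le_trans hK)// invfM mulrC.
  rewrite [leLHS](_ : _ = (M%:R * (tau ^+ K) ^+ s * 4) *
     (M%:R * tau ^+ K) ^+ m); last by rewrite exprMn; ring.
  apply: ler_pM => //.
  - by rewrite !mulr_ge0 ?exprn_ge0 ?(ltW tau0) ?(ltW M0).
  - by rewrite ?exprn_ge0 ?mulr_ge0 ?exprn_ge0 ?(ltW tau0) ?(ltW M0).
  - lra.
exists h, e; split => //.
- by move=> m; rewrite /h muln_gt0 K0; lia.
- move=> m; apply: (@le_trans _ _ (2^-1 * (1 - 2^-1 ^+ m))); last first.
    by rewrite ler_piMr// gerBl exprn_ge0.
  elim: m => [|m IH]; first by rewrite big_ord0 expr0 subrr mulr0.
  rewrite big_ord_recr /= exprS; have := eM m; have := IH; lra.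
- move=> n m c k x kM h1 h2.
  rewrite /e mulrAC divff ?pnatr_eq0// mul1r.
  apply: (@avg_pair_count_small _ _ _ p01 n c k (h m) x _ eps theta) => //.
    exact: ltW.
  have g1 := gdel k kM.
  apply: (@le_trans _ _ ((h m)%:R * (1 + del / 2))); last first.
    by rewrite ler_wpM2l// /eps; lra.
  rewrite /h !natrM -mulrA ler_wpM2l// (natrD _ m.+1 s) (natrD _ m s) -addn1 natrD.
  have : 0 <= m%:R :> R by [].
  move=> m0; have : 0 <= del * m%:R by rewrite mulr_ge0// ltW.
  lra.
Qed.

End Thresholds.

(** * Starting the growth from one surviving pair *)

Section Seed.
Variables (R : realType) (M : nat) (p : 'I_M -> R).
Hypothesis p01 : forall i, 0 <= p i <= 1.
Implicit Types (s t : seq 'I_M) (x y : bool * seq 'I_M -> bool).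

Let pr01 := label_prob01 p01.

(** Otherwise the only possibly nonzero term of [gamma_1] is the wrapped one,
    [p_(M-1) p_0], which is at most 1. *)
Lemma consecutive_digits : (0 < M)%N -> 1 < cyclic_autocorrelation p 1 ->
  exists u v : 'I_M, [/\ v = u.+1 :> nat, 0 < p u & 0 < p v].
Proof.
move=> M0 g1.
have [/existsP[u /existsP[v /and3P[/eqP ? ? ?]]]|] :=
  boolP [exists u : 'I_M, exists v : 'I_M,
    [&& v == u.+1 :> nat, 0 < p u & 0 < p v]]; first by exists u, v.
move=> /existsPn H; exfalso; move: g1; apply/negP; rewrite -leNgt.
have M1 : (M.-1 < M)%N by lia.
rewrite /cyclic_autocorrelation (bigD1 (Ordinal M1))//= big1 ?addr0.
  by have /andP[? ?] := p01 (Ordinal M1);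
    have /andP[? ?] := p01 (cyclic_shift (Ordinal M1) 1); rewrite mulr_ile1.
move=> j jM; have /existsPn/(_ (cyclic_shift j 1)) := H j.
have jlt : (j.+1 < M)%N.
  have := ltn_ord j; rewrite leq_eqVlt => /orP[/eqP e|//].
  have {}e : (j : nat) = M.-1 by lia.
  by move: jM; rewrite -(inj_eq val_inj) /= e eqxx.
rewrite /= addn1 modn_small// eqxx /= negb_and -!leNgt.
have /andP[a0 _] := p01 j; have /andP[b0 _] := p01 (cyclic_shift j 1).
move=> /orP[le|le].
  have -> : p j = 0 by apply/le_anti/andP.
  by rewrite mul0r.
have -> : p (cyclic_shift j 1) = 0 by apply/le_anti/andP.
by rewrite mulr0.
Qed.

Lemma position_cat s t :
  position (s ++ t) = (position s * M ^ size t + position t)%N.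
Proof.
elim/last_ind: t => [|t i IH]; first by rewrite cats0 muln1 addn0.
by rewrite -rcons_cat !position_rcons IH size_rcons expnSr; lia.
Qed.

Lemma alive_cat y b s t :
  alive y b (s ++ t) =
  alive y b s && all (fun k => y (b, s ++ take k t)) (iota 1 (size t)).
Proof.
elim/last_ind: t => [|t i IH]; first by rewrite cats0 andbT.
rewrite -rcons_cat alive_rcons IH -andbA; congr (_ && _).
rewrite size_rcons -(addn1 (size t)) iotaD all_cat /= andbT; congr (_ && _).
  apply: eq_in_all => k; rewrite mem_iota => /andP[k1].
  by rewrite addnC addn1 ltnS => ks; rewrite -[in RHS]cats1 takel_cat.
by rewrite addnC addn1 take_oversize ?size_rcons// rcons_cat.
Qed.

Variables (u v : 'I_M).
Hypothesis (uv : v = u.+1 :> nat).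

(** Words over ['I_2] stand for the words over the two consecutive digits [u] and
    [v = u + 1]. *)
Definition two_digits (a : 'I_2) : 'I_M := if a == 0 then u else v.

Lemma two_digits_inj : injective two_digits.
Proof.
move=> a b; rewrite /two_digits.
have uv' : u <> v by move=> e; move: uv; rewrite e; lia.
case: eqP => [->|a0]; case: eqP => [->|b0] // e.
- by case: (uv' (esym e)).
- apply: ord_inj; move: a0 b0 => /eqP a0 /eqP b0.
  move: a0 b0; rewrite -!(inj_eq val_inj) /=.
  by have := ltn_ord a; have := ltn_ord b; lia.
Qed.

(** The labels of all descendants of [s] and of [t], during [n0] generations,
    that are reached through the two digits only. *)
Definition seed_labels n0 s t : seq (bool * seq 'I_M) :=
  [seq (bw.1, (if bw.1 then t else s) ++ map two_digits bw.2)
  | bw <- levels 2 0 n0].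

(** The bound depends neither on the generation [n] nor on the pair, which is what
    allows the trials to be repeated. *)
Lemma seed_chance n n0 s t x : size s = n -> size t = n ->
  Num.min (p u) (p v) ^+ size (levels 2 0 n0) <=
  avg (label_prob p) (levels M n n0)
    (fun y => (all y (seed_labels n0 s t))%:R) x.
Proof.
move=> sn tn.
have E : avg (label_prob p) (levels M n n0)
    (fun y => (all y (seed_labels n0 s t))%:R) x =
    \prod_(i <- seed_labels n0 s t) label_prob p i.
  transitivity (avg (label_prob p) (levels M n n0)
    (fun y => \prod_(i <- seed_labels n0 s t) (y i)%:R) x).
    apply: (eq_avg pr01) => y _.
    elim: (seed_labels n0 s t) => [|i r IH] /=; first by rewrite big_nil.
    by rewrite big_cons -IH -natrM mulnb.
  rewrite (@avg_prod _ _ _ pr01 _ _ (fun i => pred1 i)).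
  - apply: eq_big_seq => i /mapP[[b w]]; rewrite mem_levels => wn ->.
    rewrite (avg_coord pr01)// mem_levels size_cat size_map /=.
    by case: b; lia.
  - rewrite map_inj_in_uniq ?levels_uniq// => -[b w] [b' w'] _ _ /= [<-].
    move=> /eqP; rewrite eqseq_cat// => /andP[_ /eqP /(inj_map two_digits_inj)].
    by move=> ->.
  - by move=> i _ a b ab; rewrite ab//= eqxx.
  - by move=> i j _ _ ij a /= /eqP ->.
rewrite E /seed_labels big_map -[leLHS]mulr1 -iter_mulr -(count_predT (levels 2 0 n0)).
rewrite -big_const_seq big_seq [leRHS]big_seq.
have pu := p01 u; have pv := p01 v.
apply: ler_prod => -[b w]; rewrite mem_levels => wn.
rewrite le_min !(andP pu).1 (andP pv).1 /=.
case/lastP: w wn => [|w a] /=; first by lia.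
rewrite map_rcons -rcons_cat label_prob_rcons /two_digits => _.
by case: ifP => _; rewrite ge_min lexx ?orbT.
Qed.

Lemma seed_alive y n n0 s t : size s = n -> size t = n ->
  alive2 y (s, t) -> all y (seed_labels n0 s t) ->
  forall w w', size w = n0 -> size w' = n0 ->
  alive2 y (s ++ map two_digits w, t ++ map two_digits w').
Proof.
move=> sn tn /andP[/= al1 al2] /allP al w w' wn wn'.
rewrite /alive2 /= !alive_cat al1 al2 /= !size_map.
apply/andP; split; apply/allP => k; rewrite mem_iota => kn.
- rewrite -map_take; apply: al; apply/mapP; exists (false, take k w) => //.
  by rewrite mem_levels size_take; case: (ltnP k); lia.
- rewrite -map_take; apply: al; apply/mapP; exists (true, take k w') => //.
  by rewrite mem_levels size_take; case: (ltnP k); lia.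
Qed.

(** Appending the same two-digit word to [s] and [t] keeps the scaled
    offset: these are the pairs for [b = false]. For [b = true] the words agree
    except in their last digit, [u] below [s] and [v] below [t]. *)
Lemma seed_pair_count y n n1 s t (b : bool) : size s = n -> size t = n ->
  alive2 y (s, t) -> all y (seed_labels n1.+1 s t) ->
  (2 ^ n1 <= pair_count y (n + n1.+1)
     ((M ^ n1.+1)%N%:Z * offset (s, t) + b%:Z))%N.
Proof.
move=> sn tn al sl; rewrite -(size_words 2 n1).
pose a1 : 'I_2 := if b then 1 else 0.
pose f w := (s ++ map two_digits (rcons w 0), t ++ map two_digits (rcons w a1)).
rewrite -(size_map f) /pair_count -size_filter; apply: uniq_leq_size.
  rewrite map_inj_in_uniq ?words_uniq// => w w' wn wn' [/eqP].
  rewrite eqseq_cat// => /andP[_ /eqP /(inj_map two_digits_inj) /rcons_inj[->]].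
  by [].
move=> st /mapP[w]; rewrite mem_words => /eqP wn ->.
rewrite mem_filter mem_pairs !size_cat !size_map !size_rcons wn sn tn eqxx !andbT.
apply/andP; split; first by apply: (seed_alive sn tn al sl); rewrite size_rcons wn.
rewrite /offset /= !position_cat !map_rcons !size_rcons !position_rcons.
rewrite !size_map wn; apply/eqP.
have -> : (two_digits a1 : nat) = (two_digits 0%R + b)%N.
  by rewrite /two_digits eqxx /a1; case b => /=; rewrite ?addn0 // uv addn1.
by rewrite !PoszD !PoszM; ring.
Qed.

End Seed.

Section Chance.
Variables (R : realType) (M : nat) (p : 'I_M -> R).
Hypothesis p01 : forall i, 0 <= p i <= 1.
Hypothesis M2 : (2 <= M)%N.

(** Seed, then growth. Whatever the labels up to generation [n], the column below
    a surviving pair remains populated with conditional probability at least [q]. *)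
Lemma uniform_chance :
  (forall k, (k <= M)%N -> 1 < cyclic_autocorrelation p k) ->
  exists (n0 : nat) (q : R), 0 < q /\
  forall n s t x m, size s = n -> size t = n -> alive2 x (s, t) ->
    q <= avg (label_prob p) (levels M n (n0 + m))
      (fun y => (all_segments_ge (fun=> 1%N) y (n + n0)
                   ((M ^ n0)%N%:Z * offset (s, t)) m)%:R) x.
Proof.
move=> g1; have pr01 := label_prob01 p01.
have [h [e [h0 e0 se He]]] := growth_thresholds p01 M2 g1.
have [u [v [uv pu pv]]] := consecutive_digits p01 (ltnW M2) (g1 1%N (ltnW M2)).
(* The seed yields [2 ^ h 0 >= h 0] pairs at both ends. *)
pose n0 := (h 0%N).+1.
pose q1 := Num.min (p u) (p v) ^+ size (levels 2 0 n0).
have q10 : 0 < q1 by rewrite exprn_gt0// lt_min pu pv.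
exists n0, (q1 / 2); split; first by rewrite divr_gt0.
have half (S : R) : S <= 2^-1 -> 2^-1 <= 1 - S by lra.
move=> n s t x m sn tn al; rewrite levels_cat avg_cat.
set c := _%:Z * _.
apply: (@le_trans _ _ (avg (label_prob p) (levels M n n0)
   (fun y => 2^-1 * (all y (seed_labels u v n0 s t))%:R) x)).
  rewrite avgZ mulrC ler_wpM2l// seed_chance//.
apply: (le_avg pr01) => y yx.
have aly : alive2 y (s, t).
  rewrite (_ : alive2 y (s, t) = alive2 x (s, t))//.
  by congr (_ && _); apply: eq_alive => w /= ws; apply: yx;
    rewrite mem_levels; lia.
apply: (@le_trans _ _ ((segment_ge y (n + n0) c 0 (h 0%N))%:R *
   (1 - \sum_(i < m) e i))).
  have := se m; have [sl|_] := boolP (all y _) => [sm|_]; last first.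
    by rewrite mulr0 mulr_ge0// (le_trans _ (half _ (se m))).
  rewrite (_ : segment_ge _ _ _ _ _ = true); first by rewrite mulr1 mul1r; exact: half.
  apply/allP => k; rewrite mem_iota expn0 add0n => /andP[_ k2].
  rewrite addn0 mul1r; apply: (@leq_trans (2 ^ h 0%N)%N); first exact/ltnW/ltn_expl.
  have := seed_pair_count uv (k == 1%N) sn tn aly sl.
  by case: k k2 => [|[|]].
apply: (le_trans (all_segments_chance p01 M2 (n + n0) c y m e0 se He)).
apply: (le_avg pr01) => z _.
have [/allP ok|_] := boolP (all_segments_ge h z (n + n0) c m); last by [].
rewrite (_ : all_segments_ge _ _ _ _ _ = true)//.
apply/allP => i /ok /allP oki; apply/allP => k /oki; exact: leq_trans.
Qed.
End Chance.

(** * The law of the labels of two independent sets *)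

Section PairLabels.
Variables (R : realType) (M : nat) (p : 'I_M -> R).
Variables (d : measure_display) (T : measurableType d) (P : probability T R).
Variables (X : seq 'I_M -> {RV P >-> bool}).
Hypothesis hX : random_labels p X.

Definition pair_labels (w : T * T) (bs : bool * seq 'I_M) : bool :=
  if bs.1 then X bs.2 w.2 else X bs.2 w.1.

Lemma measurable_label s c : measurable (X s @^-1` [set c]).
Proof. by rewrite -[_ @^-1` _]setTI; exact: measurable_funP. Qed.

Lemma measurable_pair_labels bs c :
  measurable [set w | pair_labels w bs = c].
Proof.
case: bs => b s; rewrite /pair_labels /=; case: b.
- rewrite (_ : [set w | _] = setT `*` (X s @^-1` [set c])).
    by apply: measurableX => //; exact: measurable_label.
  by apply/seteqP; split => -[w w'] //= [].
- rewrite (_ : [set w | _] = (X s @^-1` [set c]) `*` setT).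
    by apply: measurableX => //; exact: measurable_label.
  by apply/seteqP; split => -[w w'] //= [].
Qed.

Lemma label_law b s c : P (X s @^-1` [set c]) =
  (if c then label_prob p (b, s) else 1 - label_prob p (b, s))%:E.
Proof.
have [_ X0 Xp] := hX.
have XT : P (X s @^-1` [set true]) = (label_prob p (b, s))%:E.
  by case/lastP: s => [|s i] //; rewrite label_prob_rcons Xp.
case: c => //.
rewrite (_ : X s @^-1` [set false] = ~` (X s @^-1` [set true])).
  rewrite probability_setC; last exact: measurable_label.
  by rewrite XT EFinB.
by apply/seteqP; split => w /=; case: (X s w).
Qed.

(** A cylinder for the labels of both trees is a rectangle: its sides are
    cylinders for one tree each, to which the independence of [X] applies. *)
Lemma cylinder_pair_labels K b : uniq K ->
  (P \x P)%E (cylinder pair_labels K b) = (cylinder_prob (label_prob p) K b)%:E.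
Proof.
move=> uK; have [indep _ _] := hX.
pose side c := [seq bs.2 | bs <- K & bs.1 == c].
have side_uniq c : uniq (side c).
  rewrite map_inj_in_uniq ?filter_uniq// => -[a s] [a' s'].
  by rewrite !mem_filter /= => /andP[/eqP-> _] /andP[/eqP-> _] /= ->.
have mem_side c s : (s \in side c) = ((c, s) \in K).
  apply/mapP/idP => [[[a t]]|cs]; first by rewrite mem_filter /= => /andP[/eqP-> ?] ->.
  by exists (c, s) => //; rewrite mem_filter /= eqxx.
pose C c := \bigcap_(s in [set` side c]) X s @^-1` [set b (c, s)].
have mC c : measurable (C c).
  apply: fin_bigcap_measurable; first exact: finite_seq.
  by move=> s _; exact: measurable_label.
have PC c : P (C c) =
    (\prod_(bs <- K | bs.1 == c)
      (if b bs then label_prob p bs else 1 - label_prob p bs))%:E.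
  rewrite indep// -(big_filter K).
  transitivity (\big[*%E/1%E]_(s <- side c)
    (if b (c, s) then label_prob p (c, s) else 1 - label_prob p (c, s))%:E).
    by apply: eq_bigr => s _; exact: label_law.
  rewrite prodEFin /side big_map; congr (_%:E).
  apply: eq_big_seq => -[a s].
  by rewrite mem_filter /= => /andP[/eqP ->].
have -> : cylinder pair_labels K b = C false `*` C true.
  apply/seteqP; split => [[w w'] H|[w w'] [/= H1 H2]].
    split => s /=; rewrite mem_side => sK; first exact: (H (false, s)).
    exact: (H (true, s)).
  move=> [[] s] sK; rewrite /pair_labels /=.
    by apply: H2; rewrite /= mem_side.
  by apply: H1; rewrite /= mem_side.
transitivity (P (C false) * P (C true))%E; first exact: product_measure1E.
rewrite !PC -EFinM /cylinder_prob; congr (_%:E).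
rewrite [RHS](bigID (fun bs => bs.1 == false)) /=; congr (_ * _).
by apply: eq_bigl => -[[] s].
Qed.

Lemma pair_labels_law (J : seq (bool * seq 'I_M))
    (A : (bool * seq 'I_M -> bool) -> bool) x : uniq J -> supported (mem J) A ->
  measurable [set w | A (pair_labels w)] /\
  (P \x P)%E [set w | A (pair_labels w)] =
  (avg (label_prob p) J (fun y => (A y)%:R) x)%:E.
Proof.
move=> uJ sA; apply: event_law => //; first exact: measurable_pair_labels.
exact: cylinder_pair_labels.
Qed.

End PairLabels.

(** * From words to points *)

Section Geometry.
Variables (R : realType) (M : nat).
Hypothesis M2 : (2 <= M)%N.
Implicit Types (s t : seq 'I_M) (y : bool * seq 'I_M -> bool).

Let M0 : 0 < M%:R :> R. Proof. by rewrite ltr0n; lia. Qed.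
Let Mn0 n : 0 < M%:R ^+ n :> R. Proof. exact: exprn_gt0. Qed.

Lemma sum_digits (i0 : 'I_M) s :
  \sum_(k < size s) (nth i0 s k : nat)%:R / M%:R ^+ k.+1 =
  (position s)%:R / M%:R ^+ size s :> R.
Proof.
elim/last_ind: s => [|s i IH]; first by rewrite big_ord0 mul0r.
rewrite size_rcons big_ord_recr /= nth_rcons ltnn eqxx position_rcons.
under eq_bigr do rewrite nth_rcons ltn_ord.
rewrite IH natrD natrM exprS.
by field; rewrite !gt_eqF.
Qed.

Lemma mary_intervalE n (s : n.-tuple 'I_M) (u : R) :
  mary_interval R s u <->
  (position s)%:R <= u * M%:R ^+ n <= (position s)%:R + 1.
Proof.
have i0 : 'I_M by exists 0%N; lia.
rewrite /mary_interval.
have -> : \sum_(k < n) (tnth s k : nat)%:R / M%:R ^+ k.+1 =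
    (position s)%:R / M%:R ^+ n :> R.
  have := sum_digits i0 s; rewrite size_tuple => <-.
  by apply: eq_bigr => k _; rewrite (tnth_nth i0).
rewrite /= in_itv /= -mulrDl.
by rewrite ler_pdivrMr// ler_pdivlMr.
Qed.

Lemma cantor_approxP y b n (u : R) :
  cantor_approx R (fun s => y (b, s)) n u <->
  exists s, [/\ size s = n, alive y b s &
    (position s)%:R <= u * M%:R ^+ n <= (position s)%:R + 1].
Proof.
split=> [[s sS /mary_intervalE su]|[s [sn al su]]].
  exists s; split => //; first exact: size_tuple.
  apply/allP => k; rewrite mem_iota size_tuple => /andP[k1].
  by rewrite addnC addn1 ltnS => kn; apply: sS; rewrite k1.
move/eqP in sn; exists (Tuple sn); last exact/mary_intervalE.
move=> k /andP[k1 kn]; apply: (allP al); rewrite mem_iota k1.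
by rewrite addnC addn1 ltnS (eqP sn).
Qed.

Lemma closed_cantor_approx (x : seq 'I_M -> bool) n :
  closed (cantor_approx R x n).
Proof.
apply: closed_bigcup => [|s _]; first exact: finite_finset.
exact: itv_closed.
Qed.

Lemma position_lt s : (position s < M ^ size s)%N.
Proof.
elim/last_ind: s => [|s i IH]; first by rewrite expn0.
rewrite position_rcons size_rcons expnSr.
have := ltn_ord i; nia.
Qed.

(** The left endpoint of a surviving interval lies in the intervals of all its
    prefixes, hence in every earlier approximation. *)
Lemma left_endpoint_approx y b n j s : (j <= n)%N -> size s = n ->
  alive y b s ->
  cantor_approx R (fun s => y (b, s)) j ((position s)%:R / M%:R ^+ n).
Proof.
move=> jn sn al; apply/cantor_approxP; exists (take j s).
have sj : size (take j s) = j by rewrite size_takel// sn.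
split => //.
  apply/allP => k; rewrite mem_iota sj => /andP[k1 kj].
  rewrite take_takel; last by lia.
  by apply: (allP al); rewrite mem_iota; lia.
have -> : position s = (position (take j s) * M ^ (n - j) + position (drop j s))%N.
  by rewrite -{1}(cat_take_drop j s) position_cat size_drop sn.
have := position_lt (drop j s); rewrite size_drop sn.
set a := position (take j s); set b' := position _; set e := (n - j)%N => b'M.
have -> : M%:R ^+ n = M%:R ^+ e * M%:R ^+ j :> R.
  by rewrite -exprD /e subnK.
have b'M' : b'%:R <= M%:R ^+ e :> R by rewrite -natrX ler_nat ltnW.
have -> : (a * M ^ e + b')%:R / (M%:R ^+ e * M%:R ^+ j) * M%:R ^+ j =
    a%:R + b'%:R / M%:R ^+ e :> R.
  by rewrite natrD natrM natrX; field; rewrite !gt_eqF.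
by rewrite lerDl lerD2l divr_ge0 ?(ltW (Mn0 e))//= ler_pdivrMr// mul1r.
Qed.

(** A pair of intervals with offset [e] has its differences in [[e - 1, e + 1]],
    so only the offsets [c] and [c + 1] reach the open column [c]. *)
Lemma difference_column y n (c : int) (z : R) : (0 < n)%N ->
  algebraic_difference (cantor_set R (fun s => y (true, s)))
    (cantor_set R (fun s => y (false, s))) z ->
  c%:~R < z * M%:R ^+ n < (c + 1)%:~R ->
  (0 < pair_count y n c + pair_count y n (c + 1)%R)%N.
Proof.
move=> n0 [v Fv [u Fu <-]] /andP[lt1 lt2].
have /cantor_approxP[s [sn als /andP[s1 s2]]] := Fu n n0.
have /cantor_approxP[t [tn alt /andP[t1 t2]]] := Fv n n0.
rewrite mulrBl in lt1 lt2.
have E : (offset (s, t))%:~R = (position t)%:R - (position s)%:R :> R.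
  by rewrite /offset /= intrB.
have d1 : c - 1 < offset (s, t).
  rewrite -(ltr_int R) intrB E; lra.
have d2 : offset (s, t) < c + 1 + 1.
  rewrite -(ltr_int R) intrD E; move: lt2; rewrite !intrD; lra.
have : offset (s, t) = c \/ offset (s, t) = c + 1 by lia.
have st : (s, t) \in pairs M n by rewrite mem_pairs sn tn eqxx.
have al : alive2 y (s, t) by rewrite /alive2 als alt.
rewrite addn_gt0 /pair_count -!has_count.
by case=> e; apply/orP; [left|right]; apply/hasP; exists (s, t) => //;
  rewrite al e /=.
Qed.



(** Every point [z] of the column [c] is approximated, at each generation, by the
    offset of a surviving pair: take the integer part of [z] in units of that
    generation. *)
Lemma segments_pair y n (c : int) m (z : R) :
  all_segments_ge (fun=> 1%N) y n c m ->
  c%:~R <= z * M%:R ^+ n <= (c + 1)%:~R ->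
  exists s t, [/\ size s = (n + m)%N, size t = (n + m)%N, alive2 y (s, t) &
    `|(position t)%:R / M%:R ^+ (n + m) - (position s)%:R / M%:R ^+ (n + m) - z|
     <= (M%:R ^+ (n + m))^-1].
Proof.
move=> /allP/(_ m); rewrite mem_iota add0n ltnS leqnn => /(_ isT) /allP H.
move=> /andP[z1 z2].
pose a := z * M%:R ^+ (n + m) - M%:R ^+ m * c%:~R.
have aE : a = M%:R ^+ m * (z * M%:R ^+ n - c%:~R).
  by rewrite /a exprD; ring.
have a0 : 0 <= a by rewrite aE mulr_ge0 ?(ltW (Mn0 m))// subr_ge0.
have aM : a <= (M ^ m)%:R.
  rewrite aE natrX ler_piMr ?(ltW (Mn0 m))//.
  by rewrite lerBlDr addrC; move: z2; rewrite intrD.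
pose k := Num.truncn a.
have /andP[k1 k2] := truncn_itv a0.
have kM : (k <= M ^ m)%N by rewrite -(ler_nat R) (le_trans k1).
have := H k; rewrite mem_iota add0n ltnS kM => /(_ isT).
rewrite -has_count => /hasP[[s t]]; rewrite mem_pairs => /andP[/eqP sn /eqP tn].
move=> /andP[al /eqP off]; exists s, t; split => //.
have E : (offset (s, t))%:~R = (position t)%:R - (position s)%:R :> R.
  by rewrite /offset /= intrB.
rewrite -mulrBl -E off intrD intrM -[z in X in `|X|](mulfK (lt0r_neq0 (Mn0 (n + m)))).
rewrite -mulrBl normrM [X in _ * X]gtr0_norm ?invr_gt0//.
rewrite ler_piMl ?invr_ge0 ?(ltW (Mn0 _))// ler_norml.
have -> : ((M ^ m)%N%:Z)%:~R = M%:R ^+ m :> R by rewrite -natrX.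
move: k1 k2; rewrite -/k -natr1 /a => k1 k2.
have -> : (k%:Z)%:~R = k%:R :> R by [].
by apply/andP; split; lra.
Qed.

(** By compactness, the left endpoints [a m] given by [segments_pair] for a fixed
    [z] have a cluster point [u]. The approximations of both sets are closed and
    decreasing, so [u] and [u + z] belong to the limit sets. *)
Lemma segments_fill_interval y n (c : int) :
  (forall m, all_segments_ge (fun=> 1%N) y n c m) ->
  contains_interval
    (algebraic_difference (cantor_set R (fun s => y (true, s)))
       (cantor_set R (fun s => y (false, s)))).
Proof.
move=> H; pose lo : R := c%:~R / M%:R ^+ n; pose hi : R := (c + 1)%:~R / M%:R ^+ n.
exists `[lo, hi]%classic; split; first exact: interval_is_interval.
  have lh : lo < hi by rewrite ltr_pM2r ?invr_gt0// ltr_int; lia.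
  by exists lo, hi; rewrite /= !in_itv /= !lexx (ltW lh).
move=> z /=; rewrite in_itv /= /lo /hi ler_pdivrMr// ler_pdivlMr// => zc.
have /choice[st stP] m : exists st : seq 'I_M * seq 'I_M,
    [/\ size st.1 = (n + m)%N, size st.2 = (n + m)%N, alive2 y st &
    `|(position st.2)%:R / M%:R ^+ (n + m) -
      (position st.1)%:R / M%:R ^+ (n + m) - z| <= (M%:R ^+ (n + m))^-1].
  by have [s [t ?]] := segments_pair (H m) zc; exists (s, t).
pose a m : R := (position (st m).1)%:R / M%:R ^+ (n + m).
pose b m : R := (position (st m).2)%:R / M%:R ^+ (n + m).
have a01 m : `[0, 1]%classic (a m).
  have [sn _ _ _] := stP m.
  rewrite /= in_itv /= /a divr_ge0 ?(ltW (Mn0 _))//=.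
  by rewrite ler_pdivrMr// mul1r -natrX ler_nat -sn ltnW// position_lt.
have [|u [u01 cu]] := @segment_compact R 0 1 (a @ \oo) _.
  by exists 0%N => // m _; exact: a01.
have near_u (e : R) j : 0 < e -> exists m,
    [/\ (j <= n + m)%N, `|u - a m| < e & `|u + z - b m| < e].
  move=> e0; have e20 : 0 < e / 2 by rewrite divr_gt0.
  have [N hN] : exists N, (2^-1 : R) ^+ N <= e / 3.
    by apply: expr_small; rewrite ?divr_gt0// invr_ge0 ler0n invf_lt1// ltr1n.
  have [] := cu [set a m | m in [set m | (N + j <= m)%N]] (ball u (e / 2)).
  - by exists (N + j)%N => // m /= hm; exists m.
  - exact: nbhsx_ballx.
  move=> _ [[m /= hm <-]]; rewrite /ball /= => ub.
  exists m; split; [lia | lra |].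
  have [_ _ _] := stP m; rewrite -/(a m) -/(b m) => ab.
  have small : (M%:R ^+ (n + m))^-1 <= e / 3 :> R.
    apply: le_trans hN; rewrite exprVn lef_pV2 ?posrE ?exprn_gt0//.
    rewrite -!natrX ler_nat; apply: (@leq_trans (M ^ N)%N).
      by case: (N) => // N'; rewrite leq_exp2r.
    by rewrite leq_exp2l//; lia.
  have -> : u + z - b m = (u - a m) - (b m - a m - z) by ring.
  apply: le_lt_trans (ler_normB _ _) _; lra.
have adh A v (f : nat -> R) : closed A ->
    (forall e, 0 < e -> exists m, A (f m) /\ `|v - f m| < e) -> A v.
  move=> cA fA; rewrite ((closure_id A).1 cA) => B /nbhs_ballP[e /= e0 eB].
  by have [m [Af vf]] := fA e e0; exists (f m); split => //; apply: eB.
have Fu : cantor_set R (fun s => y (false, s)) u.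
  move=> j _; apply: (adh _ _ a); first exact: closed_cantor_approx.
  move=> e /(near_u _ j)[m [jm ua _]]; exists m; split => //.
  have [sn _ /andP[al _] _] := stP m.
  exact: left_endpoint_approx al.
have Fv : cantor_set R (fun s => y (true, s)) (u + z).
  move=> j _; apply: (adh _ _ b); first exact: closed_cantor_approx.
  move=> e /(near_u _ j)[m [jm _ ub]]; exists m; split => //.
  have [_ tn /andP[_ al] _] := stP m.
  exact: left_endpoint_approx al.
by exists (u + z) => //; exists u => //; rewrite addrC addKr.
Qed.

End Geometry.

(** * Columns that die out *)

Section Supports.
Variable M : nat.

Lemma supported_alive2 n st : st \in pairs M n ->
  supported (mem (levels M 0 n)) (fun y => alive2 y st).
Proof.
case: st => s t; rewrite mem_pairs => /andP[/eqP sn /eqP tn] x y xy.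
by congr (_ && _); apply: eq_alive => u /= us; apply: xy;
  rewrite /= mem_levels; lia.
Qed.

Lemma supported_pair_count n c :
  supported (mem (levels M 0 n)) (fun y => pair_count y n c).
Proof.
move=> x y xy; apply: eq_in_count => st stn.
by rewrite (supported_alive2 stn xy).
Qed.

End Supports.

Section NoInterval.
Variables (R : realType) (M : nat) (p : 'I_M -> R).
Hypothesis M2 : (2 <= M)%N.
Hypothesis p01 : forall i, 0 <= p i <= 1.
Variables (d : measure_display) (T : measurableType d) (P : probability T R).
Variables (X : seq 'I_M -> {RV P >-> bool}).
Hypothesis hX : random_labels p X.

Fixpoint subcolumn (k : nat) (c : int) (m : nat) : int :=
  if m is m'.+1 then M%:Z * subcolumn k c m' + k%:Z else c.

Lemma digit_correlation_ge0 z : 0 <= digit_correlation p z.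
Proof.
apply: sumr_ge0 => i _; apply: sumr_ge0 => j _.
by rewrite mulr_ge0// ?(andP (p01 _)).1.
Qed.

Lemma pair_count_le (y : bool * seq 'I_M -> bool) n c :
  (pair_count y n c <= size (pairs M n))%N.
Proof. exact: count_size. Qed.

(** The counts at the two ends of the column evolve by a nonnegative matrix
    whose column sums are [gamma_k] and [gamma_(k+1)]; the maximum of the two
    expectations thus contracts by [r]. *)
Lemma avg_subcolumn (k : nat) (r : R) n c m x : (k < M)%N ->
  cyclic_autocorrelation p k <= r -> cyclic_autocorrelation p k.+1 <= r ->
  avg (label_prob p) (levels M n m)
    (fun y => (pair_count y (n + m) (subcolumn k c m))%:R) x
    <= r ^+ m * (size (pairs M n))%:R /\
  avg (label_prob p) (levels M n m)
    (fun y => (pair_count y (n + m) (subcolumn k c m + 1))%:R) x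
    <= r ^+ m * (size (pairs M n))%:R.
Proof.
move=> kM g1 g2; have pr01 := label_prob01 p01.
have step k' : (k' <= M)%N -> cyclic_autocorrelation p k' <= r ->
  forall m, avg (label_prob p) (levels M n m)
    (fun y => (pair_count y (n + m) (subcolumn k c m))%:R) x
    <= r ^+ m * (size (pairs M n))%:R ->
  avg (label_prob p) (levels M n m)
    (fun y => (pair_count y (n + m) (subcolumn k c m + 1))%:R) x
    <= r ^+ m * (size (pairs M n))%:R ->
  avg (label_prob p) (levels M n m.+1)
    (fun y => (pair_count y (n + m.+1) (M%:Z * subcolumn k c m + k'%:Z))%:R) x
    <= r ^+ m.+1 * (size (pairs M n))%:R.
  move=> k'M gk' j h1 h2; rewrite /= avg_cat addnS.
  rewrite (_ : avg _ (levels M n j) _ x = avg (label_prob p) (levels M n j)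
     (fun y => digit_correlation p k'%:Z *
         (pair_count y (n + j) (subcolumn k c j))%:R +
       digit_correlation p (k'%:Z - M%:Z) *
         (pair_count y (n + j) (subcolumn k c j + 1))%:R) x);
    last by apply: (eq_avg pr01) => y _; exact: avg_pair_count.
  rewrite avgD !avgZ exprS.
  apply: le_trans (lerD (ler_wpM2l (digit_correlation_ge0 _) h1)
                        (ler_wpM2l (digit_correlation_ge0 _) h2)) _.
  rewrite -mulrDl digit_correlation_cyclic// mulrA.
  have r0 : 0 <= r.
    by apply: le_trans gk'; rewrite -digit_correlation_cyclic// addr_ge0//
      digit_correlation_ge0.
  by rewrite !ler_wpM2r ?exprn_ge0.
elim: m => [|m [IH1 IH2]].
  by rewrite /= addn0 expr0 mul1r !ler_nat !pair_count_le.
split; first exact: step (ltnW kM) g1 _ IH1 IH2.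
have -> : subcolumn k c m.+1 + 1 = M%:Z * subcolumn k c m + k.+1%:Z.
  by rewrite /= -addn1 PoszD addrA.
exact: step kM g2 _ IH1 IH2.
Qed.

(** Markov inequality: a populated column has total count at least 1, while the
    expected count tends to 0. *)
Lemma column_dies (k : nat) (r : R) n c : (k < M)%N -> r < 1 ->
  cyclic_autocorrelation p k <= r -> cyclic_autocorrelation p k.+1 <= r ->
  (P \x P)%E.-negligible [set w : T * T | forall m,
     (0 < pair_count (pair_labels X w) (n + m) (subcolumn k c m) +
          pair_count (pair_labels X w) (n + m) (subcolumn k c m + 1)%R)%N].
Proof.
move=> kM r1 g1 g2; have pr01 := label_prob01 p01.
have r0 : 0 <= r.
  by apply: le_trans g1; rewrite -digit_correlation_cyclic 1?ltnW// addr_ge0//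
    digit_correlation_ge0.
pose A m (y : bool * seq 'I_M -> bool) :=
  (0 < pair_count y (n + m) (subcolumn k c m) +
                pair_count y (n + m) (subcolumn k c m + 1)%R)%N.
have AJ m : supported (mem (levels M 0 (n + m))) (A m).
  by move=> x y xy; rewrite /A !(supported_pair_count _ xy).
have law m := pair_labels_law hX xpredT (levels_uniq M 0 (n + m)) (AJ m).
pose Z := \bigcap_m [set w : T * T | A m (pair_labels X w)].
have mZ : measurable Z by apply: bigcap_measurable => // m _; have [] := law m.
pose B : R := (size (pairs M n))%:R.
have QZ m : ((P \x P)%E Z <= (r ^+ m * (2 * B))%:E)%E.
  have [mA QA] := law m.
  apply: (@le_trans _ _ ((P \x P)%E [set w : T * T | A m (pair_labels X w)])).
    by apply: le_measure; rewrite ?inE// => w; apply.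
  rewrite QA lee_fin levels_cat avg_cat add0n.
  rewrite -[leRHS](avg_cst (label_prob p) (levels M 0 n) _ xpredT).
  apply: (le_avg pr01) => y _.
  apply: (@le_trans _ _ (avg (label_prob p) (levels M n m) (fun y =>
    (pair_count y (n + m) (subcolumn k c m))%:R +
    (pair_count y (n + m) (subcolumn k c m + 1)%R)%:R) y)).
    apply: (le_avg pr01) => z _; rewrite -natrD ler_nat /A.
    by case: (_ + _)%N.
  have [h1 h2] := avg_subcolumn n c m y kM g1 g2.
  rewrite avgD mulrCA mulr_natl mulr2n; exact: lerD.
exists Z; split => //; last by move=> w H m _; exact: H.
apply/eqP; rewrite eq_le measure_ge0 andbT.
apply/lee_addgt0Pr => e e0; rewrite add0e.
have [m hm] : exists m, r ^+ m <= e / (2 * B + 1).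
  apply: expr_small; first by rewrite r0 r1.
  by rewrite divr_gt0// ltr_wpDl// mulr_ge0.
apply: le_trans (QZ m) _; rewrite lee_fin.
have B0 : 0 <= 2 * B by rewrite mulr_ge0.
apply: le_trans (ler_wpM2r B0 hm) _.
by rewrite mulrAC ler_pdivrMr ?ler_pM2l ?lerDl// ltr_wpDl.
Qed.

Lemma subcolumn_bounds (k : nat) c m : (k < M)%N ->
  M%:R ^+ m * c%:~R <= (subcolumn k c m)%:~R :> R /\
  (subcolumn k c m + 1)%:~R <= M%:R ^+ m * (c + 1)%:~R :> R.
Proof.
move=> kM; elim: m => [|m [IH1 IH2]]; first by rewrite !mul1r.
have M0 : 0 <= M%:R :> R by [].
rewrite /= !exprS -!mulrA; split.
  apply: le_trans (ler_wpM2l M0 IH1) _.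
  by rewrite intrD intrM lerDl ler0z.
apply: le_trans (ler_wpM2l M0 IH2).
rewrite -[M%:R]/((M%:Z)%:~R : R) -intrM ler_int mulrDr mulr1.
by rewrite -addrA lerD2l; lia.
Qed.

(** An interval contains a column, and the midpoint of an empty subcolumn of that
    column is not a difference. There are countably many columns. *)
Lemma no_interval_ae (k : 'I_M) :
  cyclic_autocorrelation p k < 1 -> cyclic_autocorrelation p k.+1 < 1 ->
  {ae (P \x P)%E, forall w : T * T, ~ contains_interval
     (algebraic_difference (cantor_set R (fun s => X s w.2))
                           (cantor_set R (fun s => X s w.1)))}.
Proof.
move=> g1 g2.
pose r := Num.max (cyclic_autocorrelation p k) (cyclic_autocorrelation p k.+1).
have r1 : r < 1 by rewrite gt_max g1.
pose N (nc : nat * int) := [set w : T * T | forall m,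
     (0 < pair_count (pair_labels X w) (nc.1 + m) (subcolumn k nc.2 m) +
          pair_count (pair_labels X w) (nc.1 + m) (subcolumn k nc.2 m + 1)%R)%N].
have negN nc : (P \x P)%E.-negligible (N nc).
  by apply: (@column_dies k r); rewrite // le_max lexx ?orbT.
pose U i := if unpickle i is Some nc then N nc else set0.
have negU i : (P \x P)%E.-negligible (U i).
  by rewrite /U; case: unpickle => //; exact: negligible_set0.
apply: negligibleS (negligible_bigcup negU) => w /= /contrapT.
move=> [J [Jint [a [b [Ja Jb ab]]] JD]].
have M0 n : 0 < M%:R ^+ n :> R by rewrite exprn_gt0// ltr0n; lia.
have [n0 hn0] : exists n, (2^-1 : R) ^+ n <= (b - a) / 2.
  by apply: expr_small; rewrite ?divr_gt0 ?subr_gt0// invr_ge0 ler0n invf_lt1// ltr1n.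
pose n := n0.+1.
have hn : 2 <= (b - a) * M%:R ^+ n.
  have h : 2^-1 ^+ n0 <= (b - a) / 2 by [].
  rewrite exprVn in h.
  have : 1 <= (b - a) / 2 * 2 ^+ n0.
    by rewrite -ler_pdivrMr ?exprn_gt0// mul1r.
  have : 2 ^+ n0 <= M%:R ^+ n :> R.
    rewrite /n -!natrX ler_nat; apply: (@leq_trans (2 ^ n0.+1)%N).
      by rewrite leq_exp2l.
    by rewrite leq_exp2r.
  move=> /(ler_wpM2l (_ : 0 <= (b - a) / 2)) h1 h2.
  have := le_trans h2 (h1 _); rewrite divr_ge0 ?subr_ge0 ?(ltW ab)// => /(_ isT).
  lra.
(* As [b - a] spans two columns of generation [n], the column [c] lies inside. *)
pose c := Num.floor (a * M%:R ^+ n) + 1.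
have [c1 c2] : a * M%:R ^+ n < c%:~R /\ (c + 1)%:~R <= b * M%:R ^+ n.
  have /andP[f1 f2] := floor_itv (a * M%:R ^+ n).
  rewrite /c; split => //; rewrite !intrD; rewrite mulrBl in hn.
  lra.
exists (pickle (n, c)) => //; rewrite /U pickleK => m /=.
have [b1 b2] := subcolumn_bounds c m (ltn_ord k).
set c' := subcolumn k c m in b1 b2 *.
pose z := (c'%:~R + 2^-1) / M%:R ^+ (n + m) : R.
apply: (@difference_column R M M2 _ _ _ z) => //; last first.
  rewrite mulfVK ?gt_eqF// intrD; apply/andP; split; lra.
apply: JD; apply: (Jint a b) => //.
rewrite /z ler_pdivlMr// ler_pdivrMr// exprD !mulrA.
rewrite intrD in b2; apply/andP; split.
  have := ler_wpM2r (ltW (M0 m)) (ltW c1).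
  rewrite [c%:~R * _]mulrC; lra.
have := ler_wpM2r (ltW (M0 m)) c2.
rewrite [(c + 1)%:~R * _]mulrC => h; lra.
Qed.

End NoInterval.

(** * Repeated trials *)

Lemma measure_bigcup_le d (T : measurableType d) (R : realType)
    (mu : {measure set T -> \bar R}) (F : (set T)^nat) (b : \bar R) :
  (forall m, measurable (F m)) -> nondecreasing_seq F ->
  (forall m, (mu (F m) <= b)%E) -> (mu (\bigcup_m F m) <= b)%E.
Proof.
move=> mF ndF Fb; have mU : measurable (\bigcup_m F m) by exact: bigcup_measurable.
have cv := @nondecreasing_cvg_mu _ _ _ mu _ mF mU ndF.
rewrite -(cvg_lim _ cv)//; apply: lime_le; first exact: cvgP cv.
by apply: nearW.
Qed.

Section Interval.
Variables (R : realType) (M : nat) (p : 'I_M -> R).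
Hypothesis p01 : forall i, 0 <= p i <= 1.
Variables (d : measure_display) (T : measurableType d) (P : probability T R).
Variables (X : seq 'I_M -> {RV P >-> bool}).
Hypothesis hX : random_labels p X.
Implicit Types (y : bool * seq 'I_M -> bool).

Let Y := pair_labels X.
Let pr01 := label_prob01 p01.

(** A choice of surviving pair that depends only on the labels up to generation
    [n]. *)
Definition alive_pair y n : seq 'I_M * seq 'I_M :=
  head ([::], [::]) [seq st <- pairs M n | alive2 y st].

Definition nonextinct n y : bool := has (alive2 y) (pairs M n).

Lemma alive_pairP y n : nonextinct n y ->
  alive_pair y n \in pairs M n /\ alive2 y (alive_pair y n).
Proof.
rewrite /nonextinct /alive_pair has_filter.
case E: [seq st <- pairs M n | alive2 y st] => [|st r]; first by rewrite eqxx.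
move=> _; have : st \in [seq st <- pairs M n | alive2 y st] by rewrite E mem_head.
by rewrite mem_filter => /andP[].
Qed.

Lemma supported_nonextinct n :
  supported (mem (levels M 0 n)) (nonextinct n).
Proof.
by move=> x y xy; apply: eq_in_has => st stn; exact: (supported_alive2 stn xy).
Qed.

Lemma supported_alive_pair n :
  supported (mem (levels M 0 n)) (fun y => alive_pair y n).
Proof.
move=> x y xy; rewrite /alive_pair; congr head; apply: eq_in_filter => st stn.
exact: (supported_alive2 stn xy).
Qed.

Variables (n0 : nat) (q : R).

(** The trial started at generation [n] is still running after [n0 + m] further
    generations. *)
Definition trial n m y : bool :=
  all_segments_ge (fun=> 1%N) y (n + n0)
    ((M ^ n0)%N%:Z * offset (alive_pair y n)) m.

Lemma levels_sub n n' i : (n <= n')%N -> i \in levels M 0 n -> i \in levels M 0 n'.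
Proof. by case: i => b s nn'; rewrite !mem_levels; lia. Qed.

Lemma supported_trial n m :
  supported (mem (levels M 0 (n + (n0 + m)))) (trial n m).
Proof.
move=> x y xy; rewrite /trial.
rewrite (@supported_alive_pair n x y) => [|i /= il]; last first.
  by apply: xy; apply: levels_sub il; lia.
apply: eq_in_all => i; rewrite mem_iota => /andP[_ im].
apply: eq_all => k; congr (_ <= _)%N; apply: supported_pair_count => j jl.
by apply: xy; apply: levels_sub jl; lia.
Qed.

Lemma trialS n m m' y : (m <= m')%N -> trial n m' y -> trial n m y.
Proof.
move=> mm' /allP H; apply/allP => i; rewrite mem_iota => im.
by apply: H; rewrite mem_iota; lia.
Qed.

Hypothesis q_gt0 : 0 < q.
Hypothesis chance : forall n s t x m, size s = n -> size t = n ->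
  alive2 x (s, t) ->
  q <= avg (label_prob p) (levels M n (n0 + m))
    (fun y => (all_segments_ge (fun=> 1%N) y (n + n0)
                 ((M ^ n0)%N%:Z * offset (s, t)) m)%:R) x.

Definition all_trials_fail : set (T * T) :=
  [set w | (forall n, nonextinct n (Y w)) /\
           (forall n, exists m, ~~ trial n m (Y w))].

Lemma event_measurable n (A : (bool * seq 'I_M -> bool) -> bool) :
  supported (mem (levels M 0 n)) A -> measurable [set w | A (Y w)].
Proof.
by move=> sA; have [] := pair_labels_law hX xpredT (levels_uniq M 0 n) sA.
Qed.

Lemma measurable_all_trials_fail : measurable all_trials_fail.
Proof.
rewrite (_ : all_trials_fail = (\bigcap_n [set w | nonextinct n (Y w)]) `&`
   \bigcap_n \bigcup_m ~` [set w | trial n m (Y w)]).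
  apply: measurableI; apply: bigcap_measurable => // n _.
    exact: event_measurable (@supported_nonextinct n).
  apply: bigcup_measurable => m _; apply: measurableC.
  exact: event_measurable (@supported_trial n m).
apply/seteqP; split => w [H1 H2]; split.
- by move=> n _; exact: H1.
- by move=> n _; have [m /negP] := H2 n; exists m.
- by move=> n; exact: H1.
- by move=> n; have [m _ /negP] := H2 n I; exists m.
Qed.

Lemma trial_fails_le n m (A : (bool * seq 'I_M -> bool) -> bool) :
  supported (mem (levels M 0 n)) A -> (forall y, A y -> nonextinct n y) ->
  ((P \x P)%E [set w | A (Y w) && ~~ trial n m (Y w)] <=
   (1 - q)%:E * (P \x P)%E [set w | A (Y w)])%E.
Proof.
move=> sA Aal.
have [_ ->] := pair_labels_law hX xpredT (levels_uniq M 0 n) sA.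
have sB : supported (mem (levels M 0 (n + (n0 + m))))
    (fun y => A y && ~~ trial n m y).
  move=> x y xy; rewrite (supported_trial xy) (sA x y)// => i /= il.
  by apply: xy; apply: levels_sub il; lia.
have [_ ->] := pair_labels_law hX xpredT (levels_uniq M 0 (n + (n0 + m))) sB.
rewrite -EFinM lee_fin levels_cat avg_cat add0n -avgZ.
apply: (le_avg pr01) => y _.
have agree z : (forall i, i \notin levels M n (n0 + m) -> z i = y i) ->
    forall i, i \in levels M 0 n -> z i = y i.
  by move=> zy [b s] il; apply: zy; rewrite !mem_levels in il *; lia.
have [Ay|nAy] := boolP (A y); last first.
  rewrite mulr0 -[leRHS](avg_cst (label_prob p) (levels M n (n0 + m)) 0 y).
  apply: (le_avg pr01) => z /agree zy.
  by rewrite (sA z y zy) (negbTE nAy).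
have [] := alive_pairP (Aal _ Ay).
case E: (alive_pair y n) => [s t]; rewrite mem_pairs => /andP[/eqP sn /eqP tn] al.
apply: (@le_trans _ _ (1 + (-1) * avg (label_prob p) (levels M n (n0 + m))
    (fun y => (all_segments_ge (fun=> 1%N) y (n + n0)
                 ((M ^ n0)%N%:Z * offset (s, t)) m)%:R) y)); last first.
  by rewrite mulr1 mulN1r lerD2l lerN2; exact: chance.
apply: (@le_trans _ _ (avg (label_prob p) (levels M n (n0 + m))
    (fun y => 1 + (-1) * (all_segments_ge (fun=> 1%N) y (n + n0)
                 ((M ^ n0)%N%:Z * offset (s, t)) m)%:R) y)); last first.
  by rewrite avgD avgZ avg_cst.
apply: (le_avg pr01) => z /agree zy.
rewrite (sA z y zy) Ay /= /trial (supported_alive_pair zy) E.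
by case: all_segments_ge; rewrite /= ?mulr1 ?mulr0 ?subrr ?addr0.
Qed.

(** Induction on the number of trials. On [A], the trial started at generation
    [n] has failed by some finite generation, where the labels are known up to
    that generation and both trees still survive: the induction hypothesis
    applies to that event, whose probability is at most [1 - q] times that of
    [A]. *)
Lemma trials_fail_le k n (A : (bool * seq 'I_M -> bool) -> bool) :
  supported (mem (levels M 0 n)) A -> (forall y, A y -> nonextinct n y) ->
  0 <= 1 - q ->
  ((P \x P)%E (all_trials_fail `&` [set w | A (Y w)]) <=
   ((1 - q) ^+ k)%:E * (P \x P)%E [set w | A (Y w)])%E.
Proof.
move=> sA Aal q1; have mF := measurable_all_trials_fail.
elim: k n A sA Aal => [|k IH] n A sA Aal.
  rewrite expr0 mul1e; apply: le_measure; rewrite ?inE.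
  - apply: measurableI => //; exact: event_measurable sA.
  - exact: event_measurable sA.
  - exact: subIsetr.
pose F m := all_trials_fail `&` [set w | A (Y w) && ~~ trial n m (Y w)].
have sB m : supported (mem (levels M 0 (n + (n0 + m))))
    (fun y => A y && ~~ trial n m y).
  move=> x y xy; rewrite (supported_trial xy) (sA x y)// => i /= il.
  by apply: xy; apply: levels_sub il; lia.
have -> : all_trials_fail `&` [set w | A (Y w)] = \bigcup_m F m.
  apply/seteqP; split => w /=.
    move=> [Fw Aw]; have [m nt] := Fw.2 n.
    by exists m => //; split => //=; rewrite Aw.
  by move=> [m _ [Fw /= /andP[]]].
apply: measure_bigcup_le.
- move=> m; apply: measurableI => //; exact: event_measurable (sB m).
- move=> m m' mm'; apply/subsetPset => w [Fw /= /andP[Aw nt]]; split => //=.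
  by rewrite Aw; apply: contra nt; exact: trialS.
move=> m.
pose B y := [&& A y, ~~ trial n m y & nonextinct (n + (n0 + m)) y].
have -> : F m = all_trials_fail `&` [set w | B (Y w)].
  apply/seteqP; split => w [Fw /=]; rewrite /B.
    by move=> /andP[-> ->]; split => //=; exact: Fw.1.
  by move=> /and3P[Aw nt _]; split => //=; rewrite Aw.
have sB' : supported (mem (levels M 0 (n + (n0 + m)))) B.
  move=> x y xy; rewrite /B (supported_nonextinct xy) !andbA.
  by have := sB m x y xy; rewrite /= => ->.
apply: le_trans (IH _ _ sB' _) _; first by move=> y /and3P[].
rewrite exprSr EFinM -muleA lee_wpmul2l ?lee_fin ?exprn_ge0//.
apply: le_trans (trial_fails_le m sA Aal); apply: le_measure; rewrite ?inE.
- exact: event_measurable sB'.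
- exact: event_measurable (sB m).
- by move=> w /and3P[/= -> -> _].
Qed.

Lemma all_trials_fail_null : (P \x P)%E all_trials_fail = 0%E.
Proof.
have q1 : 0 <= 1 - q.
  rewrite subr_ge0.
  have := @chance 0 [::] [::] xpredT 0 erefl erefl isT.
  move=> /le_trans; apply.
  rewrite -[leRHS](avg_cst (label_prob p) (levels M 0 (n0 + 0)) 1 xpredT).
  by apply: (le_avg pr01) => y _; case: all_segments_ge.
have s1 : supported (mem (levels M 0 0)) (fun _ : bool * seq 'I_M -> bool => true).
  by [].
have [_ Q1] := pair_labels_law hX xpredT (levels_uniq M 0 0) s1.
have bound k : ((P \x P)%E all_trials_fail <= ((1 - q) ^+ k)%:E)%E.
  have := @trials_fail_le k 0 _ s1 (fun _ _ => isT) q1.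
  have -> : all_trials_fail `&` [set w : T * T | true] = all_trials_fail.
    by apply/seteqP; split => w // [].
  by rewrite Q1 /= mule1.
apply/eqP; rewrite eq_le measure_ge0 andbT.
apply/lee_addgt0Pr => e e0; rewrite add0e.
have [k hk] : exists k, (1 - q) ^+ k <= e.
  by apply: expr_small => //; rewrite q1 ltrBlDr ltrDl.
by apply: le_trans (bound k) _; rewrite lee_fin.
Qed.

Lemma cantor_set_nonextinct y : (2 <= M)%N ->
  cantor_set R (fun s => y (false, s)) !=set0 ->
  cantor_set R (fun s => y (true, s)) !=set0 -> forall n, nonextinct n y.
Proof.
move=> M2 [u Fu] [v Fv] [|n]; first by [].
have /(cantor_approxP M2)[s [sn als _]] := Fu n.+1 isT.
have /(cantor_approxP M2)[t [tn alt _]] := Fv n.+1 isT.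
apply/hasP; exists (s, t); first by rewrite mem_pairs sn tn eqxx.
by rewrite /alive2 als.
Qed.

End Interval.

Section IntervalAE.
Variables (R : realType) (M : nat) (p : 'I_M -> R).
Hypothesis M2 : (2 <= M)%N.
Hypothesis p01 : forall i, 0 <= p i <= 1.
Variables (d : measure_display) (T : measurableType d) (P : probability T R).
Variables (X : seq 'I_M -> {RV P >-> bool}).
Hypothesis hX : random_labels p X.

Lemma interval_ae :
  (forall k, (k <= M)%N -> 1 < cyclic_autocorrelation p k) ->
  {ae (P \x P)%E, forall w : T * T,
    cantor_set R (fun s => X s w.1) !=set0 ->
    cantor_set R (fun s => X s w.2) !=set0 ->
    contains_interval
      (algebraic_difference (cantor_set R (fun s => X s w.2))
                            (cantor_set R (fun s => X s w.1)))}.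
Proof.
move=> g1; have [n0 [q [q0 chance]]] := uniform_chance p01 M2 g1.
exists (all_trials_fail X n0); split.
- exact: (measurable_all_trials_fail hX n0).
- exact: (all_trials_fail_null p01 hX q0 chance).
move=> w /= /not_implyP[F1 /not_implyP[F2 noint]]; split.
  exact: (cantor_set_nonextinct M2 F1 F2).
move=> n; apply: contrapT => none; apply: noint.
apply: (@segments_fill_interval R M M2 (pair_labels X w) (n + n0)).
by move=> m; apply: contrapT => /negP nm; apply: none; exists m; exact: nm.
Qed.

End IntervalAE.

Theorem theorem1 (R : realType) (M : nat) (hM : (2 <= M)%N) (p : 'I_M -> R)
    (hp01 : forall i : 'I_M, 0 <= p i <= 1)
    (hpsum : 1 < \sum_(k < M) p k)
    (d : measure_display) (T : measurableType d) (P : probability T R)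
    (X : seq 'I_M -> {RV P >-> bool}) (hX : random_labels p X) :
  let gamma := cyclic_autocorrelation p in
  let F1 := fun w : T * T => cantor_set R (fun s => X s w.1) in
  let F2 := fun w : T * T => cantor_set R (fun s => X s w.2) in
  ((forall k : nat, (k <= M)%N -> 1 < gamma k) ->
     {ae (P \x P)%E, forall w, F1 w !=set0 -> F2 w !=set0 ->
        contains_interval (algebraic_difference (F2 w) (F1 w))})
  /\
  ((exists k : 'I_M, gamma k < 1 /\ gamma k.+1 < 1) ->
     {ae (P \x P)%E, forall w, F1 w !=set0 -> F2 w !=set0 ->
        ~ contains_interval (algebraic_difference (F2 w) (F1 w))}).
Proof.
move=> gamma F1 F2; split.
  by move=> g1; apply: (interval_ae hM hp01 hX); exact: g1.
move=> [k [g1 g2]].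
have := no_interval_ae hM hp01 hX g1 g2.
by apply: filterS => w noint _ _.
Qed.
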